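(* Let $r(z_1,\dots,z_{m-1},\operatorname{Re}(z_m))$ be a real-valued Lipschitz function on $\mathbb{C}^{m-1}\times\mathbb{R}$ with Lipschitz constant $C$. Set $$\Omega:=\{z\in\mathbb{C}^m:\operatorname{Im}(z_m)<r(z_1,\dots,z_{m-1},\operatorname{Re}(z_m))\}.$$ Then the envelope of holomorphy $\tilde\Omega$ of $\Omega$ is schlicht and is of the form $$\tilde\Omega=\{z\in\mathbb{C}^m:\operatorname{Im}(z_m)<\tilde r(z_1,\dots,z_{m-1},\operatorname{Re}(z_m))\},$$ where either $\tilde r\ge r$ is a Lipschitz function on $\mathbb{C}^{m-1}\times\mathbb{R}$ with the same Lipschitz constant $C$, or $\tilde r\equiv\infty$.
   Context: A function $r$ is Lipschitz with Lipschitz constant $C$ if $|r(x)-r(y)|\le C\|x-y\|$ for all $x,y$ (Euclidean norm). The envelope of holomorphy is schlicht if it is (canonically identified with) a domain in $\mathbb{C}^m$ containing $\Omega$, i.e. it is single-sheeted over $\mathbb{C}^m$. *)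

(* Defs.v *)
From HB Require Import structures.
From mathcomp Require Import all_boot all_order all_algebra.
From mathcomp Require Import complex.
From mathcomp Require Import all_classical all_reals all_analysis.
Set Implicit Arguments.
Unset Strict Implicit.
Unset Printing Implicit Defensive.
Import Order.TTheory GRing.Theory Num.Theory.
Import numFieldNormedType.Exports.
Local Open Scope classical_set_scope.
Local Open Scope ring_scope.

(* The topology and norm of the complex numbers live on the alias [R[i]^o].
   Row vectors carry the sup norm, which induces the usual topology of C^m.
   The library's norm and derivative theory needs a positive dimension, hence
   the indices [n.+1] below. *)
Notation "''CV[' R ]_ m" := 'rV[(complex R)^o]_m
  (at level 0, R at level 200, m at level 2, format "''CV[' R ]_ m").

(* Fréchet differentiability over the scalar field [R[i]], that is, complex
   differentiability; [f] is unconstrained outside of [A]. *)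
Definition holomorphic_on (R : realType) (n : nat) (A : set 'CV[R]_n.+1)
    (f : 'CV[R]_n.+1 -> (complex R)^o) : Prop :=
  forall z, A z -> differentiable f z.

(* [p] maps the open set [U] homeomorphically onto an open set of C^m, and [g]
   is the inverse of this homeomorphism (arbitrary outside of [p @` U]). *)
Definition is_chart (R : realType) (n : nat) (X : topologicalType)
    (p : X -> 'CV[R]_n.+1) (U : set X) (g : 'CV[R]_n.+1 -> X) : Prop :=
  [/\ open U, open (p @` U), {within U, continuous p},
      {within p @` U, continuous g} & forall x, U x -> g (p x) = x].

Record riemann_domain (R : realType) (n : nat) := RiemannDomain {
  rd_carrier :> topologicalType;
  rd_proj : rd_carrier -> 'CV[R]_n.+1;
  rd_hausdorff : hausdorff_space rd_carrier;
  rd_connected : connected [set: rd_carrier];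
  rd_local_homeo : forall x : rd_carrier,
    exists (U : set rd_carrier) (g : 'CV[R]_n.+1 -> rd_carrier),
      U x /\ is_chart rd_proj U g }.

Definition rd_holomorphic (R : realType) (n : nat) (X : riemann_domain R n)
    (F : X -> (complex R)^o) : Prop :=
  forall (U : set X) (g : 'CV[R]_n.+1 -> X),
    is_chart (@rd_proj R n X) U g ->
    holomorphic_on (@rd_proj R n X @` U) (F \o g).

(* [X], with the lift [alpha] of the inclusion of [D] in C^m, is a simultaneous
   holomorphic extension of [D]: all holomorphic functions on [D] extend.  Only
   the restriction of [alpha] to [D] is relevant. *)
Definition holomorphic_extension (R : realType) (n : nat)
    (D : set 'CV[R]_n.+1) (X : riemann_domain R n)
    (alpha : 'CV[R]_n.+1 -> X) : Prop :=
  [/\ {within D, continuous alpha},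
      forall z, D z -> rd_proj (alpha z) = z &
      forall f : 'CV[R]_n.+1 -> (complex R)^o, holomorphic_on D f ->
        exists F : X -> (complex R)^o, rd_holomorphic F /\
          forall z, D z -> F (alpha z) = f z].

(* The envelope of holomorphy is the maximal simultaneous extension: every other
   one maps to it, over C^m and under [D].  The map [phi] is automatically
   unique since [Y] is connected and [X] is Hausdorff. *)
Definition is_envelope_of_holomorphy (R : realType) (n : nat)
    (D : set 'CV[R]_n.+1) (X : riemann_domain R n)
    (alpha : 'CV[R]_n.+1 -> X) : Prop :=
  holomorphic_extension D alpha /\
  forall (Y : riemann_domain R n) (beta : 'CV[R]_n.+1 -> Y),
    holomorphic_extension D beta ->
    exists phi : Y -> X,
      [/\ continuous phi,
          forall y, rd_proj (phi y) = rd_proj y &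
          forall z, D z -> phi (beta z) = alpha z].

(* Being an injective local homeomorphism, the projection then identifies [X]
   with the domain [range (@rd_proj R n X)]. *)
Definition schlicht (R : realType) (n : nat) (X : riemann_domain R n) : Prop :=
  injective (@rd_proj R n X).

(* The Euclidean distance of C^n x R. *)
Definition eucl_dist (R : realType) (n : nat) (x y : 'CV[R]_n * R) : R :=
  Num.sqrt (\sum_(j < n) (complex.Re (x.1 0 j - y.1 0 j) ^+ 2 +
                          complex.Im (x.1 0 j - y.1 0 j) ^+ 2)
            + (x.2 - y.2) ^+ 2).

Definition eucl_lipschitz (R : realType) (n : nat) (C : R)
    (r : 'CV[R]_n * R -> R) : Prop :=
  forall x y, `|r x - r y| <= C * eucl_dist x y.

(* (z_1, ..., z_(m-1), Re z_m), where m = n.+1. *)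
Definition base_point (R : realType) (n : nat) (z : 'CV[R]_n.+1) : 'CV[R]_n * R :=
  (\row_j z 0 (widen_ord (leqnSn n) j), complex.Re (z 0 ord_max)).

Definition hypograph (R : realType) (n : nat) (r : 'CV[R]_n * R -> \bar R) :
    set 'CV[R]_n.+1 :=
  [set z : 'CV[R]_n.+1 | ((complex.Im (z 0 ord_max))%:E < r (base_point z))%E].

(* Main.v *)
(** The envelope is described by analytic continuation along finite chains of
balls, the same for all holomorphic functions on Omega; let the hull be the
union of the balls reached.  A translation mapping Omega into itself does the
same for the hull.  By the Lipschitz condition this applies to all translations
by the cone [Im v_m <= - C |(v', Re v_m)|]; so the hull, being open, is a
hypograph with the same constant C.

The continuations define a single-valued function on the hull.  Indeed, let
[f_t (z) = f (z - i t e_m)] for [t >= 0]; then continuing [f_t] along a chain or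
translating the continuation of [f] gives the same function for small [t], with a
bound depending only on the chain, while for large [t] the whole chain lies in
the domain of [f_t] and the continuation is [f_t] itself.  So two continuations
of [f_t] to the same point agree for large [t], and the agreement propagates down
to [t = 0] in steps of a fixed length, by the identity theorem.

Any simultaneous extension of Omega projects into the hull, as it is covered by
chains of charts.

The identity theorem is reduced to one variable, where it follows from the
bound [|h z0| <= 2 sup |h|] over the boundary of a square centered at [z0],
applied to [h = g / z ^ k] with [k] tending to infinity.  That bound comes from
Goursat's bisection argument, with dyadic Riemann sums in place of integrals. *)
Require Import Defs.
From HB Require Import structures.
From mathcomp Require Import all_boot all_order all_algebra.
From mathcomp Require Import complex.
From mathcomp Require Import all_classical all_reals all_analysis.
From mathcomp Require Import ring lra.
Set Implicit Arguments.
Unset Strict Implicit.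
Unset Printing Implicit Defensive.
Import Order.TTheory GRing.Theory Num.Theory.
Import numFieldNormedType.Exports.
Local Open Scope classical_set_scope.
Local Open Scope ring_scope.
Import ComplexField.Normc.

(** * Bisection of squares *)

Lemma geometric_small (R : realType) (M e q : R) :
  0 <= q -> q < 1 -> 0 < e -> exists k, M * q ^+ k < e.
Proof.
move=> q0 q1 e0.
have : (fun k => M * q ^+ k) @ \oo --> (0 : R).
  by apply: cvg_geometric; rewrite ger0_norm.
move=> /cvgrPdist_lt /(_ _ e0) [k _ /(_ k (leqnn k))] /=.
by rewrite sub0r normrN => h; exists k; apply: le_lt_trans h; exact: ler_norm.
Qed.

(** If [P] failed, it would fail on a quarter, then on a quarter of that one, and so on; the nested
    squares shrink to a point, where the local hypothesis is contradicted. This replaces a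
    compactness argument. *)
Lemma square_bisection (R : realType) (P : R -> R -> R -> Prop) (x y l : R) :
  0 < l ->
  (forall a b s, 0 < s -> P a b (s / 2) -> P (a + s / 2) b (s / 2) ->
     P a (b + s / 2) (s / 2) -> P (a + s / 2) (b + s / 2) (s / 2) -> P a b s) ->
  (forall u v, x <= u <= x + l -> y <= v <= y + l ->
     exists2 d, 0 < d & forall a b s, 0 < s < d ->
       x <= a -> a + s <= x + l -> y <= b -> b + s <= y + l ->
       a <= u <= a + s -> b <= v <= b + s -> P a b s) ->
  P x y l.
Proof.
move=> l0 Psub Ploc; apply: contrapT => nP.
have next_ex (t : R * R * R) : exists t' : R * R * R,
    0 < t.2 -> ~ P t.1.1 t.1.2 t.2 ->
    [/\ ~ P t'.1.1 t'.1.2 t'.2, t'.2 = t.2 / 2,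
        t.1.1 <= t'.1.1 <= t.1.1 + t.2 / 2 &
        t.1.2 <= t'.1.2 <= t.1.2 + t.2 / 2].
  move: t => [[a b] s] /=.
  have [s0|] := pselect (0 < s); last by exists (a, b, s).
  have [p1|n1] := pselect (P a b (s / 2)); last first.
    by exists (a, b, s / 2) => /= _ _; split => //; lra.
  have [p2|n2] := pselect (P (a + s / 2) b (s / 2)); last first.
    by exists (a + s / 2, b, s / 2) => /= _ _; split => //; lra.
  have [p3|n3] := pselect (P a (b + s / 2) (s / 2)); last first.
    by exists (a, b + s / 2, s / 2) => /= _ _; split => //; lra.
  have [p4|n4] := pselect (P (a + s / 2) (b + s / 2) (s / 2)); last first.
    by exists (a + s / 2, b + s / 2, s / 2) => /= _ _; split => //; lra.
  by exists (a, b, s) => /= _ /(_ (Psub _ _ _ s0 p1 p2 p3 p4)).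
have [next nextP] := choice next_ex.
pose q k := iter k next (x, y, l).
have qP k : [/\ 0 < (q k).2, (q k).2 = l * 2^-1 ^+ k &
    ~ P (q k).1.1 (q k).1.2 (q k).2].
  elim: k => [|k [s0 sE nPk]]; first by rewrite /= expr0 mulr1.
  have [] := nextP _ s0 nPk; rewrite -/(q k) /= -/(q k) => h1 h2 _ _.
  by split => //; rewrite h2 ?sE ?exprS; [lra|ring].
have qS k : [/\ (q k.+1).2 = (q k).2 / 2,
    (q k).1.1 <= (q k.+1).1.1 <= (q k).1.1 + (q k).2 / 2 &
    (q k).1.2 <= (q k.+1).1.2 <= (q k).1.2 + (q k).2 / 2].
  by have [s0 _ nPk] := qP k; have [] := nextP _ s0 nPk.
have qM k j : [/\ (q k).1.1 <= (q (j + k)%N).1.1,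
    (q (j + k)%N).1.1 + (q (j + k)%N).2 <= (q k).1.1 + (q k).2,
    (q k).1.2 <= (q (j + k)%N).1.2 &
    (q (j + k)%N).1.2 + (q (j + k)%N).2 <= (q k).1.2 + (q k).2].
  elim: j => [|j [h1 h2 h3 h4]]; first by rewrite add0n; split; lra.
  have [e2 e0 e1] := qS (j + k)%N; rewrite addSn; split; lra.
(* Each lower corner lies below the upper end of every other square, so the suprema [u] and [v] of
   the lower corners give a point of all the squares. *)
have qle k j : (q j).1.1 <= (q k).1.1 + (q k).2 /\
    (q j).1.2 <= (q k).1.2 + (q k).2.
  have [s0 _ _] := qP k; have [s0' _ _] := qP j.
  have [kj|/ltnW jk] := leqP k j.
    by have [] := qM k (j - k)%N; rewrite subnK // => *; split; lra.
  by have [] := qM j (k - j)%N; rewrite subnK // => *; split; lra.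
pose u := sup (range (fun k => (q k).1.1)).
pose v := sup (range (fun k => (q k).1.2)).
have uP k : (q k).1.1 <= u <= (q k).1.1 + (q k).2.
  apply/andP; split.
    apply: ub_le_sup; last by exists k.
    by exists (x + l) => _ [j _ <-]; have [] := qle 0 j.
  by apply: ge_sup; [exists (q k).1.1, k|move=> _ [j _ <-]; have [] := qle k j].
have vP k : (q k).1.2 <= v <= (q k).1.2 + (q k).2.
  apply/andP; split.
    apply: ub_le_sup; last by exists k.
    by exists (y + l) => _ [j _ <-]; have [] := qle 0 j.
  by apply: ge_sup; [exists (q k).1.2, k|move=> _ [j _ <-]; have [] := qle k j].
have [d d0 dP] := Ploc u v (uP 0%N) (vP 0%N).
have [k kd] : exists k, l * 2^-1 ^+ k < d by apply: geometric_small => //; lra.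
have [s0 sE nPk] := qP k; apply: nPk.
have [h1 h2 h3 h4] := qM 0%N k; rewrite addn0 in h1 h2 h3 h4.
by apply: dP => //; rewrite s0 sE.
Qed.

(** * Riemann sums along the boundary of a square *)

Section RiemannSums.
Local Open Scope complex_scope.
Variable R : realType.
Implicit Types (f g : R[i] -> R[i]) (p v z : R[i]).

(** The composite midpoint rule with 2^k nodes on the segment from [p] to [p + v]; the recursion by
    halves lets sums be subdivided exactly. *)
Fixpoint dyadic_mean f (k : nat) p v : R[i] :=
  if k is j.+1
  then (dyadic_mean f j p (v / 2) + dyadic_mean f j (p + v / 2) (v / 2)) / 2
  else f (p + v / 2).

(** The mean is formed by taking midpoints only, so midpoint-convex conditions pass from the values
    to it: bounds on the norm, or on real and imaginary parts. *)
Lemma dyadic_mean_ind (Q : R[i] -> Prop) f k p v :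
  (forall x y, Q x -> Q y -> Q ((x + y) / 2)) ->
  (forall t : R, 0 <= t <= 1 -> Q (f (p + t%:C * v))) ->
  Q (dyadic_mean f k p v).
Proof.
move=> Qmid; elim: k p v => [|k IHk] p v Qf /=.
  have -> : p + v / 2 = p + (2^-1 : R)%:C * v.
    by rewrite fmorphV rmorphMn rmorph1 mulrC.
  by apply: Qf; lra.
have half (t : R) : t%:C * (v / 2) = (t / 2)%:C * v.
  by rewrite rmorphM fmorphV rmorphMn rmorph1 /=; ring.
apply: Qmid; apply: IHk => t t01.
  by rewrite half; apply: Qf; lra.
have -> : p + v / 2 + t%:C * (v / 2) = p + ((1 + t) / 2)%:C * v.
  rewrite half [((1 + t) / 2)%:C]rmorphM !fmorphV !rmorphMn /= rmorphM.
  by rewrite rmorphD fmorphV rmorphMn rmorph1 /=; field.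
by apply: Qf; lra.
Qed.

Lemma dyadic_meanD f g h k p v : (forall z, h z = f z + g z) ->
  dyadic_mean h k p v = dyadic_mean f k p v + dyadic_mean g k p v.
Proof.
move=> hE; elim: k p v => [|k IHk] p v /=; first exact: hE.
by rewrite !IHk; field.
Qed.

Lemma dyadic_meanZ f h c k p v : (forall z, h z = c * f z) ->
  dyadic_mean h k p v = c * dyadic_mean f k p v.
Proof.
move=> hE; elim: k p v => [|k IHk] p v /=; first exact: hE.
by rewrite !IHk; field.
Qed.

Lemma dyadic_mean_affine f c l k p v : (forall z, f z = c + l * z) ->
  dyadic_mean f k p v = c + l * (p + v / 2).
Proof.
move=> fE; elim: k p v => [|k IHk] p v /=; first exact: fE.
by rewrite !IHk; field.
Qed.

(* A Riemann sum for the integral of [f] along the boundary of the square of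
   side [s] with lower left corner [a + ib]. *)
Definition square_sum f (k : nat) (a b s : R) : R[i] :=
  s%:C * (dyadic_mean f k (a +i* b) s%:C
          - dyadic_mean f k (a +i* (b + s)) s%:C)
  + 'i * s%:C * (dyadic_mean f k ((a + s) +i* b) ('i * s%:C)
                 - dyadic_mean f k (a +i* b) ('i * s%:C)).

(** The inner edges occur twice with opposite signs and cancel exactly, since level [k.+1] on a long
    edge is level [k] on its two halves. *)
Lemma square_sum_split f k a b s :
  square_sum f k.+1 a b (s + s) =
  square_sum f k a b s + square_sum f k (a + s) b s
  + square_sum f k a (b + s) s + square_sum f k (a + s) (b + s) s.
Proof.
rewrite /square_sum /=.
have -> : (s + s)%:C / 2 = s%:C by rewrite rmorphD /=; field.
have -> : 'i * (s + s)%:C / 2 = 'i * s%:C by rewrite rmorphD /=; field.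
have hD x y : x +i* y + s%:C = (x + s) +i* y by simpc.
have vD x y : x +i* y + 'i * s%:C = x +i* (y + s) by simpc.
rewrite !hD !vD !addrA rmorphD /=.
by field.
Qed.

Lemma square_sumD f g h k a b s : (forall z, h z = f z + g z) ->
  square_sum h k a b s = square_sum f k a b s + square_sum g k a b s.
Proof. by move=> hE; rewrite /square_sum !(dyadic_meanD _ _ _ hE); ring. Qed.

Lemma square_sumZ f h c k a b s : (forall z, h z = c * f z) ->
  square_sum h k a b s = c * square_sum f k a b s.
Proof. by move=> hE; rewrite /square_sum !(dyadic_meanZ _ _ _ hE); ring. Qed.

(** The midpoint rule is exact on affine functions: the horizontal edges contribute - i l s^2, the
    vertical ones i l s^2. *)
Lemma square_sum_affine f c l k a b s : (forall z, f z = c + l * z) ->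
  square_sum f k a b s = 0.
Proof.
move=> fE; rewrite /square_sum !(dyadic_mean_affine _ _ _ fE).
have -> : a +i* (b + s) = a +i* b + 'i * s%:C by simpc.
have -> : (a + s) +i* b = a +i* b + s%:C by simpc.
by field.
Qed.

Definition on_square (a b s : R) : set R[i] :=
  [set z | a <= complex.Re z <= a + s /\ b <= complex.Im z <= b + s].

Definition on_square_boundary (a b s : R) : set R[i] :=
  [set z | on_square a b s z /\
     [\/ complex.Re z = a, complex.Re z = a + s,
         complex.Im z = b | complex.Im z = b + s]].

Lemma normc_real (x : R) : 0 <= x -> normc x%:C = x.
Proof. by move=> x0; rewrite /= expr0n /= addr0 sqrtr_sqr ger0_norm. Qed.

Lemma normr_normc z : `|z| = (normc z)%:C. Proof. by []. Qed.

Lemma normc_ge0 z : 0 <= normc z.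
Proof. by rewrite -ler0c -normr_normc. Qed.

Lemma normc_i : normc ('i : R[i]) = 1.
Proof. by rewrite /= expr0n /= add0r expr1n sqrtr1. Qed.

Lemma normcD z w : normc (z + w) <= normc z + normc w.
Proof. by rewrite -lecR rmorphD -!normr_normc ler_normD. Qed.

Lemma normcB z w : normc (z - w) <= normc z + normc w.
Proof. by rewrite -lecR rmorphD -!normr_normc ler_normB. Qed.

Lemma Re_le_normc z : `|complex.Re z| <= normc z.
Proof. by rewrite -lecR -normr_normc normc_ge_Re. Qed.

Lemma Im_le_normc z : `|complex.Im z| <= normc z.
Proof.
rewrite -[normc z]mul1r -normc_i -normcM; apply: le_trans (Re_le_normc _).
by case: z => x y; simpc; rewrite normrN.
Qed.

Lemma normc_le_ReIm z : normc z <= `|complex.Re z| + `|complex.Im z|.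
Proof.
rewrite {1}(complexE z); apply: le_trans (normcD _ _) _.
by rewrite normcM normc_i mul1r lerD //= expr0n /= addr0 sqrtr_sqr.
Qed.

Lemma on_square_dist a b s z w : on_square a b s z -> on_square a b s w ->
  normc (z - w) <= 2 * s.
Proof.
move=> zs ws; apply: le_trans (normc_le_ReIm _) _.
case: z w zs ws => x y [x' y'] [/= h1 h2] [/= h3 h4].
have -> : 2 * s = s + s by ring.
by apply: lerD; rewrite ler_norml; lra.
Qed.

Lemma square_sum_le f k a b s M : 0 <= s ->
  (forall z, on_square_boundary a b s z -> normc (f z) <= M) ->
  normc (square_sum f k a b s) <= 4 * M * s.
Proof.
move=> s0 fM.
have edge p v : (forall t : R, 0 <= t <= 1 ->
    on_square_boundary a b s (p + t%:C * v)) ->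
    normc (dyadic_mean f k p v) <= M.
  move=> pv; apply: (@dyadic_mean_ind (fun z => normc z <= M)).
    move=> x y xM yM; rewrite normcM normcV.
    have -> : normc (2 : R[i]) = 2.
      by rewrite -(rmorph_nat (real_complex R) 2) normc_real.
    by have := normcD x y; lra.
  by move=> t /pv /fM.
have ts (t : R) : 0 <= t <= 1 -> 0 <= t * s <= s.
  by move=> t01; apply/andP; split; nra.
have tE x y (t : R) : x +i* y + t%:C * s%:C = (x + t * s) +i* y by simpc.
have tiE x y (t : R) : x +i* y + t%:C * ('i * s%:C) = x +i* (y + t * s).
  by simpc.
have e1 : normc (dyadic_mean f k (a +i* b) s%:C) <= M.
  apply: edge => t /ts t01; rewrite tE; split; first by split => /=; lra.
  by constructor 3.
have e2 : normc (dyadic_mean f k (a +i* (b + s)) s%:C) <= M.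
  apply: edge => t /ts t01; rewrite tE; split; first by split => /=; lra.
  by constructor 4.
have e3 : normc (dyadic_mean f k ((a + s) +i* b) ('i * s%:C)) <= M.
  apply: edge => t /ts t01; rewrite tiE; split; first by split => /=; lra.
  by constructor 2.
have e4 : normc (dyadic_mean f k (a +i* b) ('i * s%:C)) <= M.
  apply: edge => t /ts t01; rewrite tiE; split; first by split => /=; lra.
  by constructor 1.
apply: le_trans (normcD _ _) _; rewrite !normcM normc_i mul1r normc_real //.
have h1 := le_trans (normcB _ _) (lerD e1 e2).
have h2 := le_trans (normcB _ _) (lerD e3 e4).
have := ler_wpM2l s0 h1; have := ler_wpM2l s0 h2; lra.
Qed.

End RiemannSums.

(** * Goursat's lemma and Cauchy's bound *)

Section Goursat.
Local Open Scope complex_scope.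
Variable R : realType.
Local Notation K := (complex R)^o.
Implicit Types (f g h : K -> K) (z w : K).

(** The norm of [K] has its values in [R[i]]; this is the first-order expansion with real constants,
    suited to linear arithmetic. *)
Lemma differentiable_affine f w : differentiable f w ->
  exists l : R[i], forall e : R, 0 < e -> exists2 d : R, 0 < d &
    forall z, normc (z - w) < d ->
      normc (f z - f w - l * (z - w)) <= e * normc (z - w).
Proof.
move=> fw; have /cvg_ex[l /cvgrPdist_le fl] : derivable f w (1 : K).
  exact: diff_derivable.
exists l => e e0.
have /fl : 0 < e%:C by rewrite ltcR.
rewrite near_withinE => /nbhs_ballP[d /= d0 dP].
have dE : d = (complex.Re d)%:C by rewrite RRe_real // gtr0_real.
exists (complex.Re d); first by rewrite -ltcR -dE.
move=> z zd; have [->|zw] := eqVneq z w.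
  by rewrite !subrr mulr0 subr0 !normc0 mulr0.
have zw0 : z - w != 0 by rewrite subr_eq0.
have := dP (z - w).
rewrite -ball_normE /= sub0r normrN normr_normc dE ltcR => /(_ zd zw0) H.
rewrite -lecR rmorphM /= -!normr_normc.
rewrite -ler_pdivrMr ?normr_gt0 // -normfV -normrM.
rewrite distrC in H; apply: le_trans H; rewrite le_eqVlt; apply/orP; left.
apply/eqP; congr (`| _ |).
rewrite -[_ *: 1]/((z - w) * 1) mulr1 subrK -[_ *: _]/(_ * _) mulrC mulrBr.
by congr (_ - _); rewrite mulrCA mulVf // mulr1.
Qed.


Lemma normcD_le (x y : R[i]) (c d : R) :
  normc x <= c -> normc y <= d -> normc (x + y) <= c + d.
Proof. by move=> xc yd; apply: le_trans (normcD _ _) (lerD xc yd). Qed.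

Lemma goursat f (a b s : R) : 0 < s ->
  (forall z, on_square a b s z -> differentiable f z) ->
  forall e : R, 0 < e -> \forall k \near \oo, normc (square_sum f k a b s) <= e.
Proof.
move=> s0 fd e e0.
(* A bound proportional to the area is additive under subdivision, so bisection reduces it to small
   squares. *)
have : forall e : R, 0 < e -> exists N, forall k, (N <= k)%N ->
  normc (square_sum f k a b s) <= e * (s * s).
  move=> {}e {}e0; pose P a b s := exists N, forall k, (N <= k)%N ->
    normc (square_sum f k a b s) <= e * (s * s).
  apply: (@square_bisection R P) => //.
    move=> x y t t0 [N1 H1] [N2 H2] [N3 H3] [N4 H4].
    exists (maxn (maxn N1 N2) (maxn N3 N4)).+1 => -[//|k].
    rewrite ltnS !geq_max => /andP[/andP[/H1{}H1 /H2{}H2] /andP[/H3{}H3 /H4{}H4]].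
    rewrite [t in square_sum _ _ _ _ t](splitr t) square_sum_split.
    apply: le_trans (normcD_le (normcD_le (normcD_le H1 H2) H3) H4) _; lra.
  move=> u v uP vP.
  have [l lP] := differentiable_affine (fd (u +i* v) (conj uP vP)).
  (* The affine part has sum 0 and the remainder is at most (e / 8) (2 t) on the boundary, which
     gives 4 (e / 8) (2 t) t = e t^2. *)
  have [d d0 {}lP] := lP (e / 8) ltac:(lra).
  exists (d / 2); first lra.
  move=> x y t /andP[t0 td] xa xt yb yt ux vy; exists 0%N => k _.
  pose q z := f (u +i* v) - l * (u +i* v) + l * z.
  have fE z : f z = q z + (f z - q z) by rewrite addrC subrK.
  rewrite (square_sumD _ _ _ _ fE) (square_sum_affine _ _ _ _ (fun _ => erefl)).
  rewrite add0r.
  have {lP} : forall z, on_square_boundary x y t z ->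
      normc (f z - q z) <= e / 8 * (2 * t).
    move=> z [zs _].
    have zt := on_square_dist zs (conj ux vy : on_square x y t (u +i* v)).
    have -> : f z - q z = f z - f (u +i* v) - l * (z - (u +i* v)).
      by rewrite /q; ring.
    apply: le_trans (lP _ _) _; first lra.
    by apply: ler_wpM2l => //; lra.
  by move=> /(square_sum_le k (ltW t0)); lra.
move=> /(_ (e / (s * s))) []; first by rewrite divr_gt0 // mulr_gt0.
move=> N NP; exists N => // k /NP.
by rewrite divfK // mulf_neq0 // gt_eqF.
Qed.

End Goursat.

Section SquareSumEstimates.
Local Open Scope complex_scope.
Variable R : realType.
Local Notation K := (complex R)^o.
Implicit Types (f g h : K -> K) (z w : K).

(** The integral would be 2 pi i. On each edge, the part of the integrand that enters the imaginary
    part of the sum has a fixed sign and size at least 1 / (2 d); so each of the four edges, of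
    length 2 d, contributes at least 1, at every level [k]. *)
Lemma square_sum_inv_ge k (u v d : R) : 0 < d ->
  4 <= normc (square_sum (fun z => (z - (u +i* v))^-1) k (u - d) (v - d) (d + d)).
Proof.
move=> d0; set inv := fun z => _.
have dE : (d + d)^-1 = d / (d ^+ 2 + d ^+ 2). 
  by field; rewrite !gt_eqF ?addr_gt0 ?exprn_gt0.
have bnd (t : R) : 0 <= t <= 1 -> 
    (d + d)^-1 <= d / (d ^+ 2 + (t * (d + d) - d) ^+ 2).
  move=> t01; rewrite dE ler_pM2l // lef_pV2 ?posrE ?ltr_pwDl ?sqr_ge0 ?exprn_gt0 //.
  have /andP[t0 t1] := t01; have t1' : 0 <= 1 - t by lra.
  rewrite lerD2l; have := mulr_ge0 (mulr_ge0 t0 t1') (sqr_ge0 d); lra.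
have hE x y (t : R) : x +i* y + t%:C * (d + d)%:C = (x + t * (d + d)) +i* y.
  by simpc.
have vE x y (t : R) : x +i* y + t%:C * ('i * (d + d)%:C) = x +i* (y + t * (d + d)).
  by simpc.
have invE x y : inv (x +i* y) = ((x - u) / ((x - u) ^+ 2 + (y - v) ^+ 2))
    -i* ((y - v) / ((x - u) ^+ 2 + (y - v) ^+ 2)).
  by [].
have half (x : R[i]) : x / 2 = (complex.Re x / 2) +i* (complex.Im x / 2).
  have n2 : (2 : R[i]) != 0 by rewrite pnatr_eq0.
  apply: (mulIf n2); rewrite divfK // mulr_natr mulr2n.
  by case: x => x y; simpc => /=; congr (_ +i* _); lra.
have ReH (x y : R[i]) : complex.Re ((x + y) / 2) = (complex.Re x + complex.Re y) / 2.
  by rewrite half; case: x => ? ?; case: y.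
have ImH (x y : R[i]) : complex.Im ((x + y) / 2) = (complex.Im x + complex.Im y) / 2.
  by rewrite half; case: x => ? ?; case: y.
rewrite /square_sum.
set A := dyadic_mean _ _ _ _; set B := dyadic_mean _ _ _ _.
set C := dyadic_mean _ _ _ _; set D := dyadic_mean _ _ _ _.
have sh (w t : R) : w - d + t * (d + d) - w = t * (d + d) - d by lra.
have lo (w : R) : w - d - w = - d by lra.
have hi (w : R) : w - d + (d + d) - w = d by lra.
have hA : (d + d)^-1 <= complex.Im A.
  apply: (@dyadic_mean_ind R (fun z => (d + d)^-1 <= complex.Im z)).
    by move=> x y hx hy; rewrite ImH; lra.
  by move=> t /bnd; rewrite hE invE /= sh lo mulNr opprK sqrrN (addrC (_ ^+ 2)).
have hB : complex.Im B <= - (d + d)^-1.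
  apply: (@dyadic_mean_ind R (fun z => complex.Im z <= - (d + d)^-1)).
    by move=> x y hx hy; rewrite ImH; lra.
  by move=> t /bnd; rewrite hE invE /= sh hi lerN2 (addrC (_ ^+ 2)).
have hC : (d + d)^-1 <= complex.Re C.
  apply: (@dyadic_mean_ind R (fun z => (d + d)^-1 <= complex.Re z)).
    by move=> x y hx hy; rewrite ReH; lra.
  by move=> t /bnd; rewrite vE invE /= sh hi.
have hD : complex.Re D <= - (d + d)^-1.
  apply: (@dyadic_mean_ind R (fun z => complex.Re z <= - (d + d)^-1)).
    by move=> x y hx hy; rewrite ReH; lra.
  by move=> t /bnd; rewrite vE invE /= sh lo mulNr sqrrN lerN2.
have dd : (d + d) * (d + d)^-1 = 1 by rewrite mulfV //; lra.
apply: le_trans (Im_le_normc _); apply: le_trans (ler_norm _).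
have s0 : 0 <= d + d by lra.
have := ler_wpM2l s0 hA; have := ler_wpM2l s0 hB.
have := ler_wpM2l s0 hC; have := ler_wpM2l s0 hD.
rewrite mulrN dd; clear hA hB hC hD dd s0.
by case: A B C D => [a1 a2] [b1 b2] [c1 c2] [e1 e2] /= *; lra.
Qed.

(* [xij] stands for the square in column [i] and row [j] of a 4 x 4 grid. *)
Lemma normc_sum16_le (x00 x10 x20 x30 x01 x11 x21 x31 x02 x12 x22 x32
    x03 x13 x23 x33 : R[i]) (c e : R) :
  normc x00 <= e / 13 ->  normc x10 <= e / 13 ->  normc x20 <= e / 13 ->
  normc x30 <= e / 13 ->  normc x01 <= e / 13 ->  normc x31 <= e / 13 ->
  normc x02 <= e / 13 ->  normc x32 <= e / 13 ->  normc x03 <= e / 13 ->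
  normc x13 <= e / 13 ->  normc x23 <= e / 13 ->  normc x33 <= e / 13 ->
  normc (x11 + x21 + x12 + x22) <= c + e / 13 ->
  normc ((x00 + x10 + x01 + x11) + (x20 + x30 + x21 + x31)
         + (x02 + x12 + x03 + x13) + (x22 + x32 + x23 + x33)) <= c + e.
Proof.
move=> p00 p10 p20 p30 p01 p31 p02 p32 p03 p13 p23 p33 pin.
have -> : (x00 + x10 + x01 + x11) + (x20 + x30 + x21 + x31)
    + (x02 + x12 + x03 + x13) + (x22 + x32 + x23 + x33) =
  (x11 + x21 + x12 + x22) + x00 + x10 + x20 + x30 + x01 + x31
    + x02 + x32 + x03 + x13 + x23 + x33 by ring.
have h1 := normcD_le (normcD_le (normcD_le (normcD_le pin p00) p10) p20) p30.
have h2 := normcD_le (normcD_le (normcD_le (normcD_le h1 p01) p31) p02) p32.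
have h3 := normcD_le (normcD_le (normcD_le (normcD_le h2 p03) p13) p23) p33.
apply: le_trans h3 _; lra.
Qed.

Ltac outer_square piece := apply piece; first [lra | apply/or4P;
  first [constructor 1; lra | constructor 2; lra | constructor 3; lra
        | constructor 4; lra]].

(* Only the twelve outer squares of the 4 x 4 grid avoid the singularity at the
   center; the four inner ones make up the square of half the size. *)
Lemma square_sum_double (H : K -> K) (u v s c : R) : 0 < s ->
  (forall z, on_square (u - (s + s)) (v - (s + s)) (s + s + (s + s)) z ->
     z != u +i* v -> differentiable H z) ->
  (forall e : R, 0 < e -> \forall k \near \oo,
     normc (square_sum H k (u - s) (v - s) (s + s)) <= c + e) ->
  forall e : R, 0 < e -> \forall k \near \oo,
    normc (square_sum H k (u - (s + s)) (v - (s + s)) (s + s + (s + s))) <= c + e.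
Proof.
move=> s0 Hd Hc e e0.
have E1 (w : R) : w - (s + s) + s = w - s by lra.
have E2 (w : R) : w - (s + s) + (s + s) = w by lra.
have E3 (w : R) : w - s + s = w by lra.
(* The error is divided into 13 shares: one for each outer square, by [goursat], and one for the
   inner square of side [s + s]. *)
have piece a b : u - (s + s) <= a -> a <= u + s -> v - (s + s) <= b -> b <= v + s ->
    [|| a + s < u, u < a, b + s < v | v < b] ->
    \forall k \near \oo, normc (square_sum H k a b s) <= e / 13.
  move=> ha ha' hb hb' away; apply: goursat => // [z [za zb]|]; last by lra.
  apply: Hd; first by split; lra.
  by apply: contraTneq away => zE; move: za zb; rewrite zE /=; lra.
(* Cutting the large square into the grid uses two levels, hence [k.+2]; the inner square uses one,
   hence [k.+1] in [HcS]. *)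
suff [N _ HN] : \forall k \near \oo, normc (square_sum H k.+2
    (u - (s + s)) (v - (s + s)) (s + s + (s + s))) <= c + e.
  by exists N.+2 => // -[|[|k]] // /HN.
have HcS : \forall k \near \oo,
    normc (square_sum H k.+1 (u - s) (v - s) (s + s)) <= c + e / 13.
  have [N _ HN] := Hc (e / 13) ltac:(lra).
  by exists N => // k Nk; apply: HN; exact: leqW.
near=> k.
have p00 : normc (square_sum H k (u - (s + s)) (v - (s + s)) s) <= e / 13.
  by near: k; outer_square piece.
have p10 : normc (square_sum H k (u - s) (v - (s + s)) s) <= e / 13.
  by near: k; outer_square piece.
have p20 : normc (square_sum H k u (v - (s + s)) s) <= e / 13.
  by near: k; outer_square piece.
have p30 : normc (square_sum H k (u + s) (v - (s + s)) s) <= e / 13.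
  by near: k; outer_square piece.
have p01 : normc (square_sum H k (u - (s + s)) (v - s) s) <= e / 13.
  by near: k; outer_square piece.
have p31 : normc (square_sum H k (u + s) (v - s) s) <= e / 13.
  by near: k; outer_square piece.
have p02 : normc (square_sum H k (u - (s + s)) v s) <= e / 13.
  by near: k; outer_square piece.
have p32 : normc (square_sum H k (u + s) v s) <= e / 13.
  by near: k; outer_square piece.
have p03 : normc (square_sum H k (u - (s + s)) (v + s) s) <= e / 13.
  by near: k; outer_square piece.
have p13 : normc (square_sum H k (u - s) (v + s) s) <= e / 13.
  by near: k; outer_square piece.
have p23 : normc (square_sum H k u (v + s) s) <= e / 13.
  by near: k; outer_square piece.
have p33 : normc (square_sum H k (u + s) (v + s) s) <= e / 13.
  by near: k; outer_square piece.
have pin : normc (square_sum H k.+1 (u - s) (v - s) (s + s)) <= c + e / 13.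
  by near: k.
rewrite !square_sum_split !E1 !E2.
rewrite square_sum_split !E3 in pin.
exact: normc_sum16_le p00 p10 p20 p30 p01 p31 p02 p32 p03 p13 p23 p33 pin.
Unshelve. all: end_near.
Qed.

End SquareSumEstimates.

Section CauchyBound.
Local Open Scope complex_scope.
Variable R : realType.
Local Notation K := (complex R)^o.
Implicit Types (f g h : K -> K) (z w : K).

(** The difference quotient [H] at the center is bounded nearby and holomorphic elsewhere, so its
    square sums tend to 0. Up to this error, h z / (z - z0) and h z0 / (z - z0) have the same sums;
    the former are at most 8 d (M / d) in norm, the latter at least 4 |h z0|, whence the constant 2
    = 8 / 4. *)
Lemma cauchy_bound h (u v d M : R) : 0 < d ->
  (forall z, on_square (u - d) (v - d) (d + d) z -> differentiable h z) ->
  (forall z, on_square_boundary (u - d) (v - d) (d + d) z -> normc (h z) <= M) ->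
  normc (h (u +i* v)) <= 2 * M.
Proof.
move=> d0 hd hM; pose z0 := u +i* v.
(* Since the inverse of 0 is 0, [H z0] is 0 and the identity [GE] below holds at [z0] too. *)
pose H z : K := (h z - h z0) * (z - z0)^-1.
have Hd z : on_square (u - d) (v - d) (d + d) z -> z != z0 -> differentiable H z.
  move=> zs zz0; apply: differentiableM.
    by apply: differentiableB => //; exact: hd.
  apply: differentiableV; last by rewrite subr_eq0.
  exact: differentiableB.
have limH e : 0 < e -> \forall k \near \oo,
    normc (square_sum H k (u - d) (v - d) (d + d)) <= e.
  move=> e0.
  (* Doubling [n] times carries a bound from the square of half side d / 2^n to the given one. *)
  have iter n c : (forall e : R, 0 < e -> \forall k \near \oo,
        normc (square_sum H k (u - d * 2^-1 ^+ n) (v - d * 2^-1 ^+ n)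
          (d * 2^-1 ^+ n + d * 2^-1 ^+ n)) <= c + e) ->
      forall e : R, 0 < e -> \forall k \near \oo,
        normc (square_sum H k (u - d) (v - d) (d + d)) <= c + e.
    elim: n => [|n IHn]; first by rewrite expr0 mulr1.
    have sE : d * 2^-1 ^+ n = d * 2^-1 ^+ n.+1 + d * 2^-1 ^+ n.+1.
      by rewrite exprS; lra.
    have n0 : 0 < d * 2^-1 ^+ n.+1 by rewrite mulr_gt0 // exprn_gt0 // invr_gt0.
    have nd : d * 2^-1 ^+ n <= d.
      by rewrite -[leRHS]mulr1 ler_pM2l // exprn_ile1 //; lra.
    move=> Hn; apply: IHn; rewrite sE; apply: square_sum_double => //.
    by move=> z [zx zy]; apply: Hd; rewrite -sE in zx zy; split; lra.
  have z0s : on_square (u - d) (v - d) (d + d) z0 by split => /=; lra.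
  have [l /(_ 1 ltr01)[d1 d10 hl]] := differentiable_affine (hd _ z0s).
  pose M1 := 1 + normc l.
  have M10 : 0 < M1 by rewrite ltr_pwDl // normc_ge0.
  have HM1 z : normc (z - z0) < d1 -> normc (H z) <= M1.
    have [->|zz0] := eqVneq z z0; first by rewrite /H !subrr mul0r normc0 ltW.
    have zz0' : 0 < normc (z - z0).
      by rewrite -ltcR -normr_normc normr_gt0 subr_eq0.
    move=> /hl zl; rewrite /H normcM normcV ler_pdivrMr // mulrDl -normcM.
    rewrite -[h z - h z0](subrK (l * (z - z0))).
    by apply: le_trans (normcD _ _) _; rewrite lerD2r.
  have half01 : 0 <= 2^-1 :> R /\ 2^-1 < 1 :> R by split; lra.
  (* With s = d / 2^n, the small square lies within 4 s < d1 of [z0], where |H| <= M1, and its sum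
     is at most 4 M1 (2 s) < e / 2. *)
  have [n] : exists n, d * 2^-1 ^+ n < Num.min (d1 / 4) (e / (16 * M1)).
    apply: geometric_small; [exact: half01.1|exact: half01.2|].
    by rewrite lt_min !divr_gt0 // mulr_gt0.
  rewrite lt_min => /andP[nd1 ne].
  have n0 : 0 < d * 2^-1 ^+ n by rewrite mulr_gt0 // exprn_gt0 // invr_gt0.
  have := iter n (e / 2).
  move: (d * 2^-1 ^+ n) n0 nd1 ne => s s0 nd1 ne.
  move=> it; rewrite (splitr e); apply: it; last by lra.
  move=> e' e'0; exists 0%N => // k _ /=.
  apply: le_trans (@square_sum_le _ _ _ _ _ _ M1 _ _) _; first by lra.
    move=> z [zs _]; apply: HM1.
    have z0s' : on_square (u - s) (v - s) (s + s) z0 by split => /=; lra.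
    by have := on_square_dist zs z0s'; lra.
  by move: ne; rewrite ltr_pdivlMr ?mulr_gt0 //; lra.
pose inv z : K := (z - z0)^-1.
have GE z : h z / (z - z0) = H z + h z0 * inv z.
  by rewrite /H /inv -mulrDl subrK.
have GM z : on_square_boundary (u - d) (v - d) (d + d) z ->
    normc (h z / (z - z0)) <= M / d.
  move=> zb; have hz := hM z zb.
  have dz : d <= normc (z - z0).
    case: zb => _; have := Re_le_normc (z - z0); have := Im_le_normc (z - z0).
    case: (z) => x y; rewrite !ler_norml.
    move: (normc _) => t /= /andP[t1 t2] /andP[t3 t4].
    by case=> ?; lra.
  rewrite normcM normcV; apply: ler_pM => //; rewrite ?invr_ge0 ?normc_ge0 //.
  by rewrite lef_pV2 // posrE; lra.
apply/ler_addgt0Pr => e e0.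
have [N _ /(_ N (leqnn N)) /= HN] := limH _ e0.
have := @square_sum_inv_ge R N u v d d0; rewrite -/z0 -/inv => inv4.
have dd0 : 0 <= d + d by lra.
have := square_sum_le N dd0 GM.
rewrite (square_sumD _ _ _ _ GE) => GN.
have := @square_sumZ R inv _ (h z0) N (u - d) (v - d) (d + d) (fun _ => erefl).
move=> SE; rewrite SE in GN.
have : normc (h z0 * square_sum inv N (u - d) (v - d) (d + d)) <= 8 * M + e.
  set S1 := square_sum H _ _ _ _ in GN HN; set S2 := _ * _ in GN *.
  have -> : S2 = (S1 + S2) - S1 by ring.
  apply: le_trans (normcB _ _) _; apply: lerD => //.
  apply: le_trans GN _; rewrite le_eqVlt; apply/orP; left; apply/eqP.
  by field; lra.
rewrite normcM.
by have := ler_wpM2l (normc_ge0 (h z0)) inv4; lra.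
Qed.

End CauchyBound.

(** * The identity theorem *)

(** Differentiability depends only on the germ: the expansion of [f] at [x] is one of [g], and
    differentials are unique. *)
Lemma near_eq_differentiable (K : numFieldType) (V W : normedModType K)
    (f g : V -> W) (x : V) :
  {near x, f =1 g} -> differentiable f x -> differentiable g x.
Proof.
move=> fg fx; have [dfc fE] := (diff_locallyP x f).1 fx.
have gE : g \o shift x = cst (g x) + 'd f x +o_ 0 id.
  apply/eqaddoP => _/posnumP[e].
  have := (eqaddoP _ _ _ _).1 fE e%:num ltac:(by []).
  have gx : g x = f x by rewrite (nbhs_singleton fg).
  have fg0 : \forall y \near 0, f (y + x) = g (y + x).
    by have := fg; rewrite (near_shift 0) subr0.
  by apply: filterS2 fg0 => y /= fgy; rewrite !fctE /= -fgy gx.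
have gd : 'd g x = 'd f x :> (V -> W) by exact: diff_unique.
by apply/diff_locallyP; rewrite gd.
Qed.

Section OneVariable.
Local Open Scope complex_scope.
Variable R : realType.
Local Notation K := (complex R)^o.
Implicit Types (f g h : K -> K) (z w : K).

(** Differentiability bounds [f] near each point, and bisection assembles the local bounds by taking
    maxima. *)
Lemma differentiable_bounded f (a b s : R) : 0 < s ->
  (forall z, on_square a b s z -> differentiable f z) ->
  exists M, forall z, on_square a b s z -> normc (f z) <= M.
Proof.
move=> s0 fd; pose P a b s := exists M : R,
  forall z, on_square a b s z -> normc (f z) <= M.
apply: (@square_bisection R P) => //.
  move=> x y t t0 [M1 H1] [M2 H2] [M3 H3] [M4 H4].
  exists (Num.max (Num.max M1 M2) (Num.max M3 M4)) => z [zx zy].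
  rewrite !le_max.
  have [zx'|zx'] := leP (complex.Re z) (x + t / 2);
    have [zy'|zy'] := leP (complex.Im z) (y + t / 2).
  - by rewrite H1 //; split; lra.
  - by rewrite H3 ?orbT //; split; lra.
  - by rewrite H2 ?orbT //; split; lra.
  - by rewrite H4 ?orbT //; split; lra.
move=> u v uP vP.
have [l /(_ 1 ltr01)[d d0 lP]] := differentiable_affine (fd (u +i* v) (conj uP vP)).
exists (d / 2); first lra.
move=> x y t /andP[t0 td] xa xt yb yt ux vy.
exists (normc (f (u +i* v)) + (1 + normc l) * d) => z zs.
have zt := on_square_dist zs (conj ux vy : on_square x y t (u +i* v)).
have zd : normc (z - (u +i* v)) < d by lra.
have -> : f z = f (u +i* v)
    + (f z - f (u +i* v) - l * (z - (u +i* v)) + l * (z - (u +i* v))).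
  by ring.
apply: normcD_le => //; rewrite mulrDl; apply: normcD_le.
  by apply: le_trans (lP _ zd) _; rewrite !mul1r ltW.
by rewrite normcM ler_wpM2l ?normc_ge0 // ltW.
Qed.

(* The functions [g z / z ^ k] are still holomorphic, so that Cauchy's bound
   gives [`|g 1| <= 2 sup `|g| / 2 ^ k] for every [k]. *)
Lemma vanishing_at_one g (d : R) : 0 < d ->
  (forall z, normc z < 8 -> differentiable g z) ->
  (forall z, normc z < d -> g z = 0) -> g 1 = 0.
Proof.
move=> d0 gd gz.
(* The square of center 1 and half side 3 lies in the disk of radius 8, and its boundary stays at
   distance at least 2 from 0, whence the decay 2^-k. *)
have sq8 z : on_square (1 - 3) (0 - 3) (3 + 3) z -> normc z < 8.
  move=> [zx zy]; apply: le_lt_trans (normc_le_ReIm _) _.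
  have : `|complex.Re z| <= 4 by rewrite ler_norml; lra.
  have : `|complex.Im z| <= 3 by rewrite ler_norml; lra.
  by lra.
have [M gM] : exists M, forall z, on_square (1 - 3) (0 - 3) (3 + 3) z ->
    normc (g z) <= M.
  by apply: differentiable_bounded => [|z /sq8 /gd //]; lra.
have bound k : normc (g 1) <= 2 * (M * 2^-1 ^+ k).
  pose h z : K := g z * (z ^+ k)^-1.
  have -> : g 1 = h (1 +i* 0) by rewrite /h [_ +i* _]/(1 : R[i]) expr1n invr1 mulr1.
  apply: (@cauchy_bound _ _ 1 0 3) => [|z /sq8 z8|z [zs zb]]; first by lra.
    (* Near 0, [h] vanishes together with [g], so the division creates no pole. *)
    have [->|z0] := eqVneq z 0.
      apply: (@near_eq_differentiable _ _ _ (cst 0)); last exact: differentiable_cst.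
      apply/nbhs_ballP; exists d%:C; first by rewrite /= ltcR.
      move=> y; rewrite -ball_normE /= sub0r normrN normr_normc ltcR => /gz.
      by rewrite /h => ->; rewrite mul0r.
    apply: differentiableM; first exact: gd.
    apply: differentiableV; last by rewrite expf_neq0.
    elim: k {h} => [|k IHk]; first exact: differentiable_cst.
    rewrite (_ : (fun _ => _) = (id : K -> K) * (fun y : K => y ^+ k)).
      exact: differentiableM.
    by apply/funext => y; rewrite exprS.
  rewrite /h normcM normcV; apply: ler_pM; rewrite ?invr_ge0 ?normc_ge0 //.
    exact: gM.
  have z2 : 2 <= normc z.
    have := Re_le_normc z; have := Im_le_normc z; rewrite !ler_norml.
    by move=> /andP[? ?] /andP[? ?]; case: zb => ?; lra.
  have -> : normc (z ^+ k) = normc z ^+ k.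
    elim: k {h} => [|k IHk]; first by rewrite !expr0 normc1.
    by rewrite !exprS normcM IHk.
  rewrite -exprVn; apply: lerXn2r; rewrite ?nnegrE ?invr_ge0 ?normc_ge0 //.
  by rewrite lef_pV2 // posrE; lra.
apply: eq0_normc; apply/eqP; rewrite eq_le normc_ge0 andbT.
apply/ler_addgt0Pr => e e0; rewrite add0r.
have [k kP] : exists k, 2 * M * 2^-1 ^+ k < e by apply: geometric_small => //; lra.
by apply: le_trans (bound k) _; rewrite mulrA ltW.
Qed.

End OneVariable.

Section IdentityTheorem.
Local Open Scope complex_scope.
Variables (R : realType) (V : normedModType R[i]).
Local Notation K := (complex R)^o.
Implicit Types (f g h : V -> K) (u v w : V) (z : K).

(** The norm of [V] is a complex number; its real part allows estimates in the ordered field [R]. *)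
Definition rnorm v : R := complex.Re `|v|.

Lemma normr_rnorm v : `|v| = (rnorm v)%:C.
Proof. by rewrite /rnorm RRe_real // ger0_real. Qed.

Lemma rnorm_ge0 v : 0 <= rnorm v.
Proof. by rewrite -ler0c -normr_rnorm. Qed.

Lemma rnorm0 : rnorm 0 = 0. Proof. by rewrite /rnorm normr0. Qed.

Lemma rnormN v : rnorm (- v) = rnorm v. Proof. by rewrite /rnorm normrN. Qed.

Lemma rnormD u v : rnorm (u + v) <= rnorm u + rnorm v.
Proof. by rewrite -lecR rmorphD /= -!normr_rnorm ler_normD. Qed.

Lemma rnormZ (z : R[i]) v : rnorm (z *: v) = normc z * rnorm v.
Proof.
by apply: complexI; rewrite rmorphM /= -!normr_rnorm normrZ -normr_normc.
Qed.

Definition rball u (r : R) : set V := [set v | rnorm (v - u) < r].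

Lemma rballE u r : rball u r = ball u r%:C.
Proof.
by apply/seteqP; split=> v;
  rewrite -ball_normE /rball /= distrC normr_rnorm ltcR.
Qed.

Lemma rball_center u r : 0 < r -> rball u r u.
Proof. by rewrite /rball /= subrr rnorm0. Qed.

Lemma open_rball u r : open (rball u r).
Proof.
have [r0|r0] := ltP 0 r; first by rewrite rballE; apply: ball_open; rewrite ltcR.
rewrite (_ : rball u r = set0); first exact: open0.
by apply/seteqP; split=> // v /=; rewrite /rball /= ltNge (le_trans r0) ?rnorm_ge0.
Qed.

Lemma rball_nbhs u r v : rball u r v -> nbhs v (rball u r).
Proof. by move=> vr; apply: open_nbhs_nbhs; split=> //; exact: open_rball. Qed.

Lemma nbhs_rballP u (A : set V) :
  nbhs u A <-> exists2 r, 0 < r & rball u r `<=` A.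
Proof.
split=> [/nbhs_ballP[e /= e0 eA]|[r r0 rA]].
  have eE : e = (complex.Re e)%:C by rewrite RRe_real // gtr0_real.
  exists (complex.Re e); first by rewrite -ltcR -eE.
  by rewrite rballE -eE.
by apply/nbhs_ballP; exists r%:C; rewrite /= ?ltcR -?rballE.
Qed.

Definition rconvex (A : set V) := forall u v (t : R), A u -> A v ->
  0 <= t <= 1 -> A (u + t%:C *: (v - u)).

Lemma rconvex_rball u r : rconvex (rball u r).
Proof.
move=> v w t vr wr /andP[t0 t1]; rewrite /rball /=.
have -> : v + t%:C *: (w - v) - u = (1 - t)%:C *: (v - u) + t%:C *: (w - u).
  have -> : w - v = (w - u) - (v - u) by rewrite opprB addrA subrK.
  rewrite rmorphB rmorph1 /= scalerBl scale1r scalerBr.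
  by rewrite addrAC addrA addrAC.
apply: le_lt_trans (rnormD _ _) _; rewrite !rnormZ !normc_real //; last lra.
have t1' : 0 <= 1 - t by lra.
have mr : Num.max (rnorm (v - u)) (rnorm (w - u)) < r by rewrite gt_max vr wr.
have vm : rnorm (v - u) <= Num.max (rnorm (v - u)) (rnorm (w - u)).
  by rewrite le_max lexx.
have wm : rnorm (w - u) <= Num.max (rnorm (v - u)) (rnorm (w - u)).
  by rewrite le_max lexx orbT.
by have := ler_wpM2l t1' vm; have := ler_wpM2l t0 wm; lra.
Qed.

Lemma rconvexI A B : rconvex A -> rconvex B -> rconvex (A `&` B).
Proof. by move=> cA cB u v t [Au Bu] [Av Bv] t01; split; [exact: cA|exact: cB]. Qed.

(** Restriction to the complex line through [v] and [w] reduces this to [vanishing_at_one]. The disk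
    |z| < 8 is mapped within r + 8 (2 r) = 17 r of [u], hence the factor 20. *)
Lemma vanishing_near f u v w (r : R) :
  (forall x, rball u (20 * r) x -> differentiable f x) ->
  rball u r v -> rball u r w -> {near v, f =1 cst 0} -> f w = 0.
Proof.
move=> fd vr wr /nbhs_rballP[d d0 fv].
have r0 : 0 < r by apply: le_lt_trans vr; exact: rnorm_ge0.
pose p z := v + z *: (w - v); pose g z := f (p z).
have vwr : rnorm (w - v) < 2 * r.
  have -> : w - v = (w - u) - (v - u) by rewrite opprB addrA subrK.
  apply: le_lt_trans (rnormD _ _) _; rewrite rnormN.
  by move: vr wr; rewrite /rball /=; lra.
have vw0 := rnorm_ge0 (w - v).
have -> : f w = g 1 by rewrite /g /p scale1r addrC subrK.
apply: (@vanishing_at_one R g (d / (2 * r))) => [|z z8|z zd].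
- by rewrite divr_gt0 // mulr_gt0.
- have pd : differentiable (p : K -> V) z by exact: differentiableD.
  have pz : rball u (20 * r) (p z).
    rewrite /rball /= /p addrAC.
    apply: le_lt_trans (rnormD _ _) _; rewrite rnormZ.
    have : normc z * rnorm (w - v) <= 8 * (2 * r).
      by apply: ler_pM; rewrite ?normc_ge0 //; exact: ltW.
    by move: vr; rewrite /rball /=; lra.
  exact: (differentiable_comp pd (fd _ pz)).
- rewrite /g fv // /rball /= /p addrC addKr rnormZ.
  move: zd; rewrite ltr_pdivlMr ?mulr_gt0 // => zd.
  apply: le_lt_trans zd; apply: ler_wpM2l; rewrite ?normc_ge0 //.
  exact: ltW.
Qed.

(** On the segment from [u] to [v], let [s] be the supremum of the parameters near which [f - g]
    vanishes. By [vanishing_near] the vanishing spreads over a ball about the point at [s], so [s]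
    is 1. *)
Theorem identity_theorem (A : set V) f g u : open A -> rconvex A ->
  (forall v, A v -> differentiable f v) ->
  (forall v, A v -> differentiable g v) ->
  A u -> {near u, f =1 g} -> forall v, A v -> f v = g v.
Proof.
move=> oA cA fd gd Au fg v Av; apply/subr0_eq.
pose h : V -> K := f - g; rewrite -[LHS]/(h v).
have hd w : A w -> differentiable h w.
  by move=> Aw; apply: differentiableB; [exact: fd|exact: gd].
pose p (t : R) := u + t%:C *: (v - u).
pose Z := [set t | 0 <= t <= 1 /\ {near p t, h =1 cst 0}].
have Z0 : Z 0.
  split; first by rewrite lexx ler01.
  rewrite /p scale0r addr0; apply: filterS fg => w fgw.
  by rewrite /h !fctE fgw subrr.
have ubZ : ubound Z 1 by move=> t [/andP[]].
have hsZ : has_sup Z by split; [exists 0|exists 1].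
pose s := sup Z.
have s01 : 0 <= s <= 1.
  by rewrite ub_le_sup //=; [apply: ge_sup => //; exists 0|exists 1].
have [r r0 rA] := (nbhs_rballP (p s) A).1 (open_nbhs_nbhs (conj oA (cA _ _ _ Au Av s01))).
pose L := rnorm (v - u); have L0 : 0 <= L by exact: rnorm_ge0.
(* The 20 is that of [vanishing_near]; the added 1 avoids a division by 0 when [u] equals [v]. *)
pose e := r / 20 / (L + 1).
have e0 : 0 < e by rewrite !divr_gt0 //; lra.
have eL : e * L < r / 20.
  have : e * (L + 1) = r / 20 by rewrite /e divfK //; lra.
  by lra.
have pst t : `|t - s| <= e -> rball (p s) (r / 20) (p t).
  move=> te; rewrite /rball /= /p opprD addrACA subrr add0r -scalerBl.
  rewrite -rmorphB rnormZ; apply: le_lt_trans eL; apply: ler_wpM2r => //.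
  by rewrite /= expr0n /= addr0 sqrtr_sqr.
have [t [t01 ht] st] := sup_adherent e0 hsZ.
have ts : t <= s by apply: ub_le_sup => //; exists 1.
have hball w : rball (p s) (r / 20) w -> h w = 0.
  have r20 : 20 * (r / 20) = r by lra.
  have hd20 x : rball (p s) (20 * (r / 20)) x -> differentiable h x.
    by rewrite r20 => /rA /hd.
  have ptr : rball (p s) (r / 20) (p t).
    by apply: pst; rewrite ler_norml; rewrite -/s in st; lra.
  by move=> ws; exact: (vanishing_near hd20 ptr ws ht).
pose t' := Num.min 1 (s + e / 2).
have Zt' : Z t'.
  split; first by rewrite /t' ge_min lexx le_min ler01 /=; lra.
  apply/nbhs_rballP.
  have : rball (p s) (r / 20) (p t').
    apply: pst; rewrite ler_norml /t'; have [h1|h1] := leP 1 (s + e / 2); lra.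
  move=> /(conj (open_rball _ _))/open_nbhs_nbhs/nbhs_rballP[d d0 dP].
  by exists d => // w /dP /hball.
have : t' <= s by apply: ub_le_sup => //; exists 1.
rewrite /t' ge_min; case/orP => [s1|h1]; last by exfalso; lra.
have -> : v = p s.
  have -> : s = 1 by lra.
  by rewrite /p scale1r addrC subrK.
by apply: hball; apply: rball_center; lra.
Qed.

End IdentityTheorem.

(** * Continuation along chains of balls *)

Section Continuation.
Local Open Scope complex_scope.
Variables (R : realType) (V : normedModType R[i]).
Local Notation K := (complex R)^o.
Implicit Types (f g h F : V -> K) (E : (V -> K) -> V -> K) (c u v w : V) (r t : R).

Definition differentiable_on (A : set V) f := forall z, A z -> differentiable f z.

Definition translate v f : V -> K := fun w => f (w + v).

Lemma differentiable_translate f v w :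
  differentiable f (w + v) -> differentiable (translate v f) w.
Proof.
move=> fd; have pd : differentiable (fun x : V => x + v) w.
  exact: differentiableD.
exact: (differentiable_comp pd fd).
Qed.

Lemma differentiable_on_eq (A : set V) f g : open A ->
  (forall w, A w -> f w = g w) -> differentiable_on A f -> differentiable_on A g.
Proof.
move=> oA fg fd w Aw; apply: near_eq_differentiable (fd w Aw).
have : nbhs w A by exact: open_nbhs_nbhs.
by apply: filterS => y /fg.
Qed.

(* [continuation D c r E]: every holomorphic function [f] on [D] can be continued
   along a chain of balls, the same for all [f], starting with a ball in [D] and
   ending with the ball of center [c] and radius [r], where the continuation is
   [E f]. *)
Inductive continuation (D : set V) : V -> R -> ((V -> K) -> V -> K) -> Prop :=
| continuation_base c r E : 0 < r -> rball c r `<=` D ->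
    (forall f, differentiable_on D f -> forall w, rball c r w -> E f w = f w) ->
    continuation D c r E
| continuation_step c r E c' r' E' : continuation D c r E -> 0 < r' ->
    rball c r `&` rball c' r' !=set0 ->
    (forall f, differentiable_on D f -> differentiable_on (rball c' r') (E' f) /\
       forall w, rball c r w -> rball c' r' w -> E' f w = E f w) ->
    continuation D c' r' E'.

Lemma continuation_differentiable D c r E f : continuation D c r E ->
  differentiable_on D f -> differentiable_on (rball c r) (E f).
Proof.
case=> [{}c {}r {}E r0 rD Ef|c0 r0 E0 {}c {}r {}E _ _ _ Ef] fD; last first.
  by have [] := Ef f fD.
apply: (@differentiable_on_eq _ f); first exact: open_rball.
  by move=> w wr; rewrite Ef.
by move=> w /rD /fD.
Qed.

Lemma rball_translate c r v w : rball (c + v) r (w + v) = rball c r w.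
Proof. by rewrite /rball /= opprD addrACA subrr addr0. Qed.

(** The new continuation is the old one conjugated by the translation; translated functions remain
    holomorphic on [D] since [D] is mapped into itself. *)
Lemma continuation_translate D c r E v : (forall w, D w -> D (w + v)) ->
  continuation D c r E -> exists E', continuation D (c + v) r E'.
Proof.
move=> Dv cE; exists (fun f => translate (- v) (E (translate v f))).
have fv f : differentiable_on D f -> differentiable_on D (translate v f).
  by move=> fD w Dw; apply/differentiable_translate/fD/Dv.
have sub_rball x s w : rball (x + v) s w <-> rball x s (w - v).
  by rewrite -(rball_translate x s v) subrK.
elim: c r E / cE => [c r E r0 rD Ef|c r E c' r' E' _ IH r'0 [q [qr qr']] Ef].
  apply: continuation_base => // [w /sub_rball /rD /Dv|f fD w /sub_rball wr].
    by rewrite subrK.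
  by rewrite /translate Ef ?subrK //; exact: fv.
apply: (continuation_step IH) => //; first exists (q + v).
  by split; rewrite rball_translate.
move=> f /fv fD; have [E'd E'E] := Ef _ fD; split.
  by move=> w /sub_rball wr; apply/differentiable_translate/E'd.
by move=> w /sub_rball wr /sub_rball wr'; rewrite /translate E'E.
Qed.

Variables (D : set V) (e : V).
Hypothesis D_semigroup : forall t w, 0 <= t -> D w -> D (w + t%:C *: e).
Hypothesis D_absorbing : forall c r, exists2 T : R, 0 <= T &
  forall t w, T <= t -> rball c r w -> D (w + t%:C *: e).

(** The family f_t of the overview, with [e] for the downward direction. *)
Let flow t f := translate (t%:C *: e) f.

Let flow_differentiable t f : 0 <= t ->
  differentiable_on D f -> differentiable_on D (flow t f).
Proof.
by move=> t0 fD w Dw; apply/differentiable_translate/fD/D_semigroup.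
Qed.

Let rball_near c r w : rball c r w -> exists2 d : R, 0 < d &
  forall t x, 0 <= t <= d -> rball w d x -> rball c r (x + t%:C *: e).
Proof.
move=> wr; pose s := r - rnorm (w - c).
have s0 : 0 < s by rewrite /s subr_gt0.
have e0 := rnorm_ge0 e.
have L0 : 0 < 1 + rnorm e by lra.
pose a := s / 2 / (1 + rnorm e).
have a0 : 0 < a by rewrite !divr_gt0.
have aE : a * (1 + rnorm e) = s / 2 by rewrite divfK // gt_eqF.
exists a => // t x /andP[t0 ta]; rewrite /rball /= => xa.
have -> : x + t%:C *: e - c = (w - c) + (x - w) + t%:C *: e.
  by rewrite addrAC [w - c + _]addrC addrA subrK.
apply: le_lt_trans (rnormD _ _) _; rewrite rnormZ normc_real //.
have h1 := rnormD (w - c) (x - w).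
have h2 : t * rnorm e <= a * rnorm e by exact: ler_wpM2r.
have sE : s = r - rnorm (w - c) by [].
by clearbody a; clearbody s; lra.
Qed.

(** Induction on the chain. Both sides are holomorphic on the intersection of the last ball with a
    translate of it, which is convex. The bound on [t] keeps a point [q] common to the last two
    balls inside both when it is translated; near [q] the induction hypothesis applies, and the
    identity theorem does the rest. *)
Lemma continuation_flow c r E : continuation D c r E ->
  exists2 d : R, 0 < d & forall t f, 0 <= t <= d -> differentiable_on D f ->
    forall w, rball c r w -> rball c r (w + t%:C *: e) ->
    E (flow t f) w = E f (w + t%:C *: e).
Proof.
move=> cE.
elim: c r E / cE => [c r E r0 rD Ef|c r E c' r' E' cE [d d0 IH] r'0 [q [qr qr']] Ef].
  exists 1 => // t f /andP[t0 _] fD w wr wer.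
  by rewrite Ef ?Ef //; exact: flow_differentiable.
have [d1 d10 qd1] := rball_near qr; have [d2 d20 qd2] := rball_near qr'.
exists (Num.min d (Num.min d1 d2)); first by rewrite !lt_min d0 d10 d20.
move=> t f /andP[t0]; rewrite !le_min => /and3P[td td1 td2] fD.
have ftD := flow_differentiable t0 fD.
pose A := rball c' r' `&` (fun w => rball c' r' (w + t%:C *: e)).
have shiftE c0 r0 : (fun w => rball c0 r0 (w + t%:C *: e)) = rball (c0 - t%:C *: e) r0.
  by apply/seteqP; split=> w; rewrite -{1}(rball_translate (c0 - _) r0 (t%:C *: e)) subrK.
have AP w : A w -> E' (flow t f) w = translate (t%:C *: e) (E' f) w.
  apply: (@identity_theorem R V A _ _ q).
  - by apply: openI; rewrite ?shiftE; exact: open_rball.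
  - by apply: rconvexI; rewrite ?shiftE; exact: rconvex_rball.
  - by move=> x [xr _]; have [+ _] := Ef _ ftD; apply.
  - by move=> x [_ xr]; apply: differentiable_translate; have [+ _] := Ef _ fD; apply.
  - by split=> //; apply: qd2; rewrite ?t0 //; exact: rball_center.
  apply/nbhs_rballP; exists (Num.min d1 d2); first by rewrite lt_min d10.
  move=> x xd; have xd1 : rball q d1 x.
    by apply: lt_le_trans xd _; rewrite ge_min lexx.
  have xd2 : rball q d2 x by apply: lt_le_trans xd _; rewrite ge_min lexx orbT.
  have x1 : rball c r (x + t%:C *: e) by apply: qd1 => //; rewrite t0.
  have x2 : rball c' r' (x + t%:C *: e) by apply: qd2 => //; rewrite t0.
  have xr : rball c r x.
    by have := qd1 0 x; rewrite scale0r addr0; apply=> //; rewrite lexx ltW.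
  have xr' : rball c' r' x.
    by have := qd2 0 x; rewrite scale0r addr0; apply=> //; rewrite lexx ltW.
  have [_ E1] := Ef _ ftD; have [_ E2] := Ef _ fD.
  by rewrite /translate E1 // E2 //; apply: IH => //; rewrite t0.
by move=> w wr wer; apply: AP.
Qed.

(** For large [t] every further ball of the chain is pushed into [D], so the translated function is
    holomorphic there and is its own continuation. *)
Lemma continuation_flow_large c r E : continuation D c r E ->
  exists2 T : R, 0 <= T & forall t f, T <= t -> differentiable_on D f ->
    forall w, rball c r w -> E (flow t f) w = f (w + t%:C *: e).
Proof.
move=> cE.
elim: c r E / cE => [c r E r0 rD Ef|c r E c' r' E' cE [T T0 IH] r'0 [q [qr qr']] Ef].
  exists 0 => // t f t0 fD w wr.
  by rewrite Ef //; exact: flow_differentiable.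
have [T1 T10 HT1] := D_absorbing c' r'.
exists (Num.max T T1); first by rewrite le_max T0.
move=> t f; rewrite ge_max => /andP[tT tT1] fD.
have ftD : differentiable_on D (flow t f).
  by apply: flow_differentiable => //; exact: le_trans tT.
have [E'd E'E] := Ef _ ftD.
apply: (@identity_theorem R V (rball c' r') _ (flow t f) q) => //.
- exact: open_rball.
- exact: rconvex_rball.
- by move=> x xr; apply/differentiable_translate/fD/HT1.
have : nbhs q (rball c r `&` rball c' r').
  by apply: open_nbhs_nbhs; split=> //; apply: openI; exact: open_rball.
by apply: filterS => x [xr xr']; rewrite E'E // IH.
Qed.

(* Two continuations agree after a large translation along the flow, where both
   are given by the function itself; by the identity theorem, the agreement then
   propagates backwards along the flow in steps of a fixed length. *)
Lemma continuation_unique c r E c' r' E' f w :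
  continuation D c r E -> continuation D c' r' E' -> differentiable_on D f ->
  rball c r w -> rball c' r' w -> E f w = E' f w.
Proof.
move=> cE cE' fD wr wr'.
have [d1 d10 flow1] := continuation_flow cE.
have [d2 d20 flow2] := continuation_flow cE'.
have [d3 d30 near3] := rball_near wr; have [d4 d40 near4] := rball_near wr'.
pose d := Num.min (Num.min d1 d2) (Num.min d3 d4).
have d0 : 0 < d by rewrite !lt_min d10 d20 d30.
have [dd1 dd2 dd3 dd4] : [/\ d <= d1, d <= d2, d <= d3 & d <= d4].
  by split; rewrite /d !ge_min lexx ?orbT.
pose A := rball c r `&` rball c' r'.
(* Near w + d e, the continuations of [g] at y + d e are those of [flow d g] at [y]; so agreement
   for [flow d g] yields agreement for [g] there, hence on all of [A]. *)
have back g : differentiable_on D g ->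
    (forall x, A x -> E (flow d g) x = E' (flow d g) x) ->
    forall x, A x -> E g x = E' g x.
  move=> gD gA.
  have wd1 : rball c r (w + d%:C *: e).
    by apply: near3; rewrite ?dd3 ?ltW //; exact: rball_center.
  have wd2 : rball c' r' (w + d%:C *: e).
    by apply: near4; rewrite ?dd4 ?ltW //; exact: rball_center.
  apply: (@identity_theorem R V A _ _ (w + d%:C *: e)) => //.
  - by apply: openI; exact: open_rball.
  - by apply: rconvexI; exact: rconvex_rball.
  - by move=> x [xr _]; exact: (continuation_differentiable cE).
  - by move=> x [_ xr]; exact: (continuation_differentiable cE').
  apply/nbhs_rballP; exists d => // x xd.
  pose y := x - d%:C *: e.
  have yw : rball w d y.
    by rewrite /rball /= /y addrAC -addrA -opprD.
  have xy : x = y + d%:C *: e by rewrite subrK.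
  have yd3 : rball w d3 y by apply: lt_le_trans yw dd3.
  have yd4 : rball w d4 y by apply: lt_le_trans yw dd4.
  have yr : rball c r y.
    by have := near3 0 y; rewrite scale0r addr0; apply=> //; rewrite lexx ltW.
  have yr' : rball c' r' y.
    by have := near4 0 y; rewrite scale0r addr0; apply=> //; rewrite lexx ltW.
  have xd3 : rball c r (y + d%:C *: e) by apply: near3 => //; rewrite dd3 ltW.
  have xd4 : rball c' r' (y + d%:C *: e) by apply: near4 => //; rewrite dd4 ltW.
  have E1 : E (flow d g) y = E g x by rewrite xy; apply: flow1; rewrite ?dd1 ?ltW.
  have E2 : E' (flow d g) y = E' g x.
    by rewrite xy; apply: flow2; rewrite ?dd2 ?ltW.
  by rewrite -E1 -E2; exact: gA.
have [T1 T10 large1] := continuation_flow_large cE.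
have [T2 T20 large2] := continuation_flow_large cE'.
(* [N] steps of length [d] lead past both thresholds [T1] and [T2]. *)
have [N Nd] : exists N, T1 + T2 <= d *+ N.
  have T0 : 0 <= (T1 + T2) / d by apply: divr_ge0; [exact: addr_ge0|exact: ltW].
  exists (Num.bound ((T1 + T2) / d)); rewrite -mulr_natl -ler_pdivrMr //.
  exact/ltW/archi_boundP.
have iter k g : differentiable_on D g ->
    (forall x, A x -> E (flow (d *+ k) g) x = E' (flow (d *+ k) g) x) ->
    forall x, A x -> E g x = E' g x.
  move=> gD; elim: k => [|k IHk].
    suff -> : flow (d *+ 0) g = g by [].
    by apply/funext => x; rewrite /flow /translate mulr0n scale0r addr0.
  rewrite (_ : flow (d *+ k.+1) g = flow d (flow (d *+ k) g)).
    move=> /back bk; apply/IHk/bk/flow_differentiable => //.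
    by rewrite mulrn_wge0 // ltW.
  by apply/funext => x; rewrite /flow /translate mulrS rmorphD scalerDl addrA.
apply: (iter N f fD _ w (conj wr wr')) => x [xr xr'].
have d_ge0 : 0 <= d *+ N by rewrite mulrn_wge0 // ltW.
by rewrite large1 ?large2 //; lra.
Qed.

End Continuation.

(** * The hull: extension of functions and connectedness *)

Section Hull.
Local Open Scope complex_scope.
Variables (R : realType) (V : normedModType R[i]).
Local Notation K := (complex R)^o.
Implicit Types (f F : V -> K) (a b u v w : V).

Definition hull (D : set V) : set V := [set z | exists c r E,
  continuation D c r E /\ rball c r z].

Lemma open_hull D : open (hull D).
Proof.
rewrite openE => z [c [r [E [cE zr]]]].
have : nbhs z (rball c r) by apply: open_nbhs_nbhs; split=> //; exact: open_rball.
by apply: filterS => w wr; exists c, r, E.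
Qed.

Lemma sub_hull D : open D -> D `<=` hull D.
Proof.
move=> oD z Dz; have [r r0 rD] := (nbhs_rballP z D).1 (open_nbhs_nbhs (conj oD Dz)).
exists z, r, id; split; last exact: rball_center.
exact: continuation_base.
Qed.

Lemma hull_translate D v : (forall w, D w -> D (w + v)) ->
  forall w, hull D w -> hull D (w + v).
Proof.
move=> Dv w [c [r [E [cE wr]]]]; have [E' cE'] := continuation_translate Dv cE.
by exists (c + v), r, E'; rewrite rball_translate.
Qed.

(** By [continuation_unique], all continuations of [f] reaching a point agree there. [F] takes this
    common value and is locally one of the continuations; off the hull its value is 0. *)
Lemma hull_extension D e f : open D ->
  (forall (t : R) w, 0 <= t -> D w -> D (w + t%:C *: e)) ->
  (forall c (r : R), exists2 T : R, 0 <= T &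
     forall t w, T <= t -> rball c r w -> D (w + t%:C *: e)) ->
  differentiable_on D f ->
  exists F, differentiable_on (hull D) F /\ forall z, D z -> F z = f z.
Proof.
move=> oD Dsemi Dabs fD.
have val_ex z : exists y : K, forall c r E,
    continuation D c r E -> rball c r z -> E f z = y.
  have [[c [r [E [cE zr]]]]|nz] := pselect (hull D z).
    exists (E f z) => c' r' E' cE' zr'.
    exact: (continuation_unique Dsemi Dabs cE' cE).
  by exists 0 => c r E cE zr; exfalso; apply: nz; exists c, r, E.
have [F FE] := choice val_ex; exists F; split.
  move=> z [c [r [E [cE zr]]]].
  apply: (@differentiable_on_eq _ _ (rball c r) (E f)) => //.
  - exact: open_rball.
  - by move=> w wr; exact: FE cE wr.
  - exact: continuation_differentiable cE fD.
move=> z Dz; have [r r0 rD] := (nbhs_rballP z D).1 (open_nbhs_nbhs (conj oD Dz)).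
have cid : continuation D z r id by exact: continuation_base.
by rewrite -(FE z z r id cid (rball_center _ r0)).
Qed.

Definition segment_between u v : set V :=
  (fun t : R => u + t%:C *: (v - u)) @` `[0, 1]%classic.

Lemma connected_segment_between u v : connected (segment_between u v).
Proof.
apply: connected_continuous_connected; first exact: segment_connected.
apply: continuous_subspaceT => t A /nbhs_rballP[d d0 dA].
have L0 := rnorm_ge0 (v - u).
have L1 : 0 < 1 + rnorm (v - u) by lra.
apply/nbhs_ballP; exists (d / (1 + rnorm (v - u))); first exact: divr_gt0. 
move=> s; rewrite -ball_normE /= ltr_pdivlMr // => ts; apply: dA.
rewrite /rball /= opprD addrACA subrr add0r -scalerBl -rmorphB rnormZ.
have -> : normc (s - t)%:C = `|t - s|.
  by rewrite /= expr0n /= addr0 sqrtr_sqr distrC.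
by apply: le_lt_trans ts; apply: ler_wpM2l; [exact: normr_ge0|lra].
Qed.

Lemma segment_between_left u v : segment_between u v u.
Proof. by exists 0; rewrite /= ?in_itv /= ?lexx ?ler01 // scale0r addr0. Qed.

Lemma segment_between_right u v : segment_between u v v.
Proof.
by exists 1; rewrite /= ?in_itv /= ?lexx ?ler01 // scale1r addrC subrK.
Qed.

(** Every [b] is joined to a fixed [a] by two segments meeting at [top b] = b + T e: the one from
    [a] has an admissible direction for large [T], the one from [b] follows [e]. Translations
    preserving [D] keep both in the hull. *)
Lemma connected_hull D e : (forall w, exists T : R, 0 <= T /\
    forall (s : R) x, 0 <= s -> D x -> D (x + s%:C *: (w + T%:C *: e))) ->
  (forall (t : R) w, 0 <= t -> D w -> D (w + t%:C *: e)) ->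
  connected (hull D).
Proof.
move=> Dcone Dsemi.
have [[a Ha]|H0] := pselect (hull D !=set0); last first.
  rewrite (_ : hull D = set0); first exact: connected0.
  by apply/seteqP; split=> // x Hx; apply: H0; exists x.
have [T TP] := choice Dcone.
pose top b := b + (T (b - a))%:C *: e.
have seg_hull w x : (forall (s : R) y, 0 <= s -> D y -> D (y + s%:C *: w)) ->
    hull D x -> segment_between x (x + w) `<=` hull D.
  move=> Dw Hx _ [s s01 <-]; move: s01; rewrite /= in_itv /= => /andP[s0 _].
  by rewrite addrAC subrr add0r; apply: hull_translate => // y; exact: Dw.
have -> : hull D = \bigcup_(b in hull D)
    (segment_between a (top b) `|` segment_between b (top b)).
  apply/seteqP; split=> [b Hb|x [b Hb] [] h].
  - by exists b => //; right; exact: segment_between_left.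
  - have [T0 Tc] := TP (b - a).
    apply: (seg_hull _ _ Tc Ha); move: h; congr (segment_between _ _ _).
    by rewrite /top addrA [a + _]addrC subrK.
  - have [T0 _] := TP (b - a); apply: (seg_hull _ b _ Hb) h.
    move=> s y s0 Dy; rewrite scalerA -rmorphM; apply: Dsemi => //.
    exact: mulr_ge0.
apply: bigcup_connected.
  by exists a => b _; left; exact: segment_between_left.
move=> b _; apply: connectedU; try exact: connected_segment_between.
by exists (top b); split; exact: segment_between_right.
Qed.

End Hull.

(** * Hypographs of Lipschitz functions *)

Section Hypograph.
Local Open Scope complex_scope.
Variables (R : realType) (n : nat).
Local Notation V := 'CV[R]_n.+1.
Implicit Types (u v w z : V) (x : 'CV[R]_n * R) (C : R).

Definition height z : R := complex.Im (z 0 ord_max).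

Definition down : V := - 'i *: delta_mx 0 ord_max.

(** The inverse of the coordinates ([base_point], [height]); [unlift] singles out the last entry. *)
Definition point_over x (y : R) : V :=
  \row_j (if unlift ord_max j is Some k then x.1 0 k else x.2 +i* y).

Lemma widen_ord_lift (k : 'I_n) : widen_ord (leqnSn n) k = lift ord_max k.
Proof. by apply: val_inj; rewrite [RHS]lift_max. Qed.

Lemma base_point_over x y : base_point (point_over x y) = x.
Proof.
case: x => x s; rewrite /base_point; congr pair.
  by apply/rowP => j; rewrite !mxE widen_ord_lift liftK.
by rewrite mxE unlift_none.
Qed.

Lemma height_over x y : height (point_over x y) = y.
Proof. by rewrite /height mxE unlift_none. Qed.

Lemma point_overE z : point_over (base_point z) (height z) = z.
Proof.
apply/rowP => j; rewrite mxE; case: unliftP => [k|] ->.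
  by rewrite /= mxE widen_ord_lift.
by rewrite /height /=; case: (z 0 ord_max).
Qed.

Lemma heightD u v : height (u + v) = height u + height v.
Proof. by rewrite /height mxE; case: (u _ _) (v _ _) => [? ?] []. Qed.

Lemma heightN v : height (- v) = - height v.
Proof. by rewrite /height mxE; case: (v _ _). Qed.

Lemma heightZ (t : R) v : height (t%:C *: v) = t * height v.
Proof. by rewrite /height mxE; case: (v _ _) => a b /=; rewrite mul0r addr0. Qed.

Lemma height_down : height down = -1.
Proof. by rewrite /height !mxE !eqxx /=; simpc => /=; lra. Qed.

Lemma base_pointD u v : base_point (u + v) =
  ((base_point u).1 + (base_point v).1, (base_point u).2 + (base_point v).2).
Proof.
rewrite /base_point /=; congr pair; first by apply/rowP => j; rewrite !mxE.
by rewrite mxE; case: (u _ _) (v _ _) => [? ?] [].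
Qed.

Lemma base_pointN v : base_point (- v) = (- (base_point v).1, - (base_point v).2).
Proof.
rewrite /base_point /=; congr pair; first by apply/rowP => j; rewrite !mxE.
by rewrite mxE; case: (v _ _).
Qed.

Lemma base_pointZ (t : R) v : base_point (t%:C *: v) =
  (t%:C *: (base_point v).1, t * (base_point v).2).
Proof.
rewrite /base_point /=; congr pair; first by apply/rowP => j; rewrite !mxE.
by rewrite mxE; case: (v _ _) => a b /=; rewrite mul0r subr0.
Qed.

Lemma base_point_down : base_point down = (0, 0).
Proof.
rewrite /base_point; congr pair; last first.
  by rewrite !mxE !eqxx /=; simpc => /=; lra.
apply/rowP => j; rewrite !mxE widen_ord_lift.
by rewrite eq_sym (negbTE (neq_lift _ _)) andbF mulr0.
Qed.

Definition base_norm v : R := eucl_dist (base_point v) (0, 0).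

Lemma eucl_dist_base u v :
  eucl_dist (base_point u) (base_point v) = base_norm (u - v).
Proof.
rewrite /base_norm /eucl_dist base_pointD base_pointN /= subr0.
congr (Num.sqrt (_ + _)); apply: eq_bigr => j _.
by rewrite !mxE subr0.
Qed.

Lemma base_normN v : base_norm (- v) = base_norm v.
Proof.
rewrite /base_norm /eucl_dist base_pointN /= !subr0 sqrrN.
congr (Num.sqrt (_ + _)); apply: eq_bigr => j _.
by rewrite !mxE !subr0; case: (v _ _) => a b /=; rewrite !sqrrN.
Qed.

Lemma base_normZ (t : R) v : 0 <= t -> base_norm (t%:C *: v) = t * base_norm v.
Proof.
move=> t0; rewrite /base_norm /eucl_dist base_pointZ /= !subr0.
rewrite -[in RHS](ger0_norm t0) -[in RHS]sqrtr_sqr -[RHS]sqrtrM ?sqr_ge0 //.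
rewrite mulrDr mulr_sumr exprMn.
congr (Num.sqrt (_ + _)); apply: eq_bigr => j _.
rewrite !mxE !subr0; case: (v _ _) => a b /=.
by rewrite !mul0r subr0 addr0 !exprMn mulrDr.
Qed.

Lemma base_norm_down (t : R) v : base_norm (v + t%:C *: down) = base_norm v.
Proof.
rewrite /base_norm base_pointD base_pointZ base_point_down scaler0 mulr0 !addr0.
by case: (base_point v).
Qed.

Lemma normc_coord v j : normc (v 0 j) <= rnorm v.
Proof.
rewrite -lecR -normr_normc -normr_rnorm [leRHS]/Num.Def.normr /= mx_normE.
by rewrite -[leLHS]nngE num_le; exact: (le_bigmax _ _ (ord0, j)).
Qed.

Lemma height_le_rnorm v : height v <= rnorm v.
Proof.
apply: le_trans (ler_norm _) _; apply: le_trans (Im_le_normc _) _.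
exact: normc_coord.
Qed.

(** The [n] entries and the real part of the last one each contribute at most the square of the sup
    norm; n + 1 is a crude bound for sqrt (n + 1). *)
Lemma base_norm_le v : base_norm v <= n.+1%:R * rnorm v.
Proof.
have sqc (z : R[i]) : complex.Re z ^+ 2 + complex.Im z ^+ 2 = normc z ^+ 2.
  by case: z => a b; rewrite /= sqr_sqrtr // addr_ge0 ?sqr_ge0.
have vj j : normc (v 0 j) ^+ 2 <= rnorm v ^+ 2.
  by rewrite lerXn2r ?nnegrE ?normc_ge0 ?rnorm_ge0 // normc_coord.
rewrite -[leRHS]ger0_norm ?mulr_ge0 ?rnorm_ge0 //.
rewrite -sqrtr_sqr ler_wsqrtr // exprMn.
apply: (@le_trans _ _ (n%:R * rnorm v ^+ 2 + rnorm v ^+ 2)); last first.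
  rewrite -[X in _ + X]mul1r -mulrDl natr1 ler_wpM2r ?sqr_ge0 //.
  by rewrite expr2 ler_peMl // ler1n.
apply: lerD.
  have -> : n%:R * rnorm v ^+ 2 = \sum_(j < n) rnorm v ^+ 2.
    by rewrite sumr_const card_ord mulr_natl.
  apply: ler_sum => j _.
  by rewrite !mxE subr0 sqc.
rewrite subr0 /=; apply: le_trans (vj ord_max).
by rewrite -sqc lerDl sqr_ge0.
Qed.

Lemma eucl_lipschitz_ge0 C (r : 'CV[R]_n * R -> R) : eucl_lipschitz C r -> 0 <= C.
Proof.
move=> /(_ (0, 1) (0, 0)) /(le_trans (normr_ge0 _)).
suff -> : @eucl_dist R n (0, 1) (0, 0) = 1 by rewrite mulr1.
rewrite /eucl_dist /= big1 ?add0r ?subr0 ?expr1n ?sqrtr1 // => j _.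
by rewrite !mxE subr0 /= expr0n addr0.
Qed.

(** Translations whose drop in height covers any decrease of a [C]-Lipschitz function over the
    base. *)
Definition in_cone C v := height v <= - (C * base_norm v).

Lemma hypograph_cone C r w v : eucl_lipschitz C r -> in_cone C v ->
  hypograph (fun x => (r x)%:E) w -> hypograph (fun x => (r x)%:E) (w + v).
Proof.
move=> hr vC; rewrite /hypograph /= !lte_fin -!/(height _) heightD.
have := hr (base_point (w + v)) (base_point w).
rewrite eucl_dist_base [w + v]addrC addrK ler_norml => /andP[h _].
by move: vC; rewrite /in_cone; lra.
Qed.

Lemma in_coneZ C (s : R) v : 0 <= s -> in_cone C v -> in_cone C (s%:C *: v).
Proof.
by move=> s0 vC; rewrite /in_cone heightZ base_normZ // mulrCA -mulrN ler_wpM2l.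
Qed.

Lemma in_cone_down C (t : R) v : C * base_norm v + height v <= t ->
  in_cone C (v + t%:C *: down).
Proof.
by move=> tv; rewrite /in_cone base_norm_down heightD heightZ height_down; lra.
Qed.

Lemma open_hypograph C r : eucl_lipschitz C r ->
  open (hypograph (fun x => (r x)%:E) : set V).
Proof.
move=> hr; rewrite openE => z Hz; apply/nbhs_rballP.
have C0 := eucl_lipschitz_ge0 hr.
have zr : height z < r (base_point z) by move: Hz; rewrite /hypograph /= lte_fin.
(* A Lipschitz constant, for [rnorm], of the height minus [r]. *)
pose L := 1 + C * n.+1%:R; have L0 : 0 < L by rewrite ltr_pwDl // mulr_ge0.
exists ((r (base_point z) - height z) / L); first by rewrite divr_gt0 // subr_gt0.
move=> w; rewrite /rball /= ltr_pdivlMr // => wz.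
rewrite /hypograph /= lte_fin -/(height _).
have := hr (base_point w) (base_point z); rewrite eucl_dist_base ler_norml => /andP[h _].
have h1 := ler_wpM2l C0 (base_norm_le (w - z)).
have := height_le_rnorm (w - z); rewrite heightD heightN => h2.
by move: wz; rewrite /L mulrDr mulr1; lra.
Qed.

End Hypograph.

(** * Open sets invariant under the cone *)

Section ConeInvariance.
Local Open Scope complex_scope.
Variables (R : realType) (n : nat) (C : R).
Local Notation V := 'CV[R]_n.+1.
Implicit Types (u v w z : V) (x : 'CV[R]_n * R) (r s : 'CV[R]_n * R -> R) (H : set V).

Lemma eucl_distC x y : @eucl_dist R n x y = eucl_dist y x.
Proof.
rewrite -(base_point_over x 0) -(base_point_over y 0) !eucl_dist_base.
by rewrite -base_normN opprB.
Qed.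

Lemma in_cone_over x y x' y' : y' <= y - C * eucl_dist x' x ->
  in_cone C (point_over x' y' - point_over x y).
Proof.
move=> yy'; rewrite /in_cone heightD heightN !height_over -eucl_dist_base.
by rewrite !base_point_over; lra.
Qed.

Lemma in_cone_downZ (t : R) : 0 <= t -> in_cone C (t%:C *: @down R n).
Proof.
move=> t0; have := @in_cone_down R n C t 0; rewrite add0r; apply.
by rewrite -(scale0r 0) -[0 : R[i]]/(0 : R)%:C base_normZ // heightZ !mul0r mulr0 addr0.
Qed.

(** The heights in [H] over a base point [x] form a down-set [S x], and lowering it by [C] times the
    distance to another base point lands in the set over the latter. So one unbounded set makes all
    of them full; otherwise the suprema are [C]-Lipschitz, and they are not attained since [H] is
    open. *)
Lemma cone_invariant_hypograph r H : 0 <= C -> open H ->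
  (forall v w, in_cone C v -> H w -> H (w + v)) ->
  hypograph (fun x => (r x)%:E) `<=` H ->
  exists rt : 'CV[R]_n * R -> \bar R,
    ((exists s, [/\ forall x, rt x = (s x)%:E, eucl_lipschitz C s &
        forall x, r x <= s x]) \/
     (forall x, rt x = +oo%E)) /\ H = hypograph rt.
Proof.
move=> C0 oH Hcone rH.
pose S x := [set y | H (point_over x y)].
have Scone x y x' y' : y' <= y - C * eucl_dist x' x -> S x y -> S x' y'.
  move=> /in_cone_over yy' /(Hcone _ _ yy').
  by rewrite addrC subrK.
have Sdown x y y' : y' <= y -> S x y -> S x y'.
  move=> yy'; apply: Scone.
  rewrite -(base_point_over x 0) eucl_dist_base subrr.
  have -> : base_norm (0 : V) = 0.
    by rewrite -(scale0r 0) -[0 : R[i]]/(0 : R)%:C base_normZ // mul0r.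
  by lra.
have Sr x y : y < r x -> S x y.
  move=> yr; apply: rH; rewrite /hypograph /= -/(height _) height_over.
  by rewrite base_point_over lte_fin.
have SE z : H z = S (base_point z) (height z) by rewrite /S /= point_overE.
have Sopen x y : S x y -> exists2 d : R, 0 < d & S x (y + d).
  move=> Sxy; have [d d0 dH] := (nbhs_rballP _ _).1 (open_nbhs_nbhs (conj oH Sxy)).
  have L0 := rnorm_ge0 (@down R n); have L1 : 0 < 1 + rnorm (@down R n) by lra.
  pose t := d / (1 + rnorm (@down R n)); have t0 : 0 < t by exact: divr_gt0.
  have tE : t * (1 + rnorm (@down R n)) = d by rewrite divfK // gt_eqF.
  (* The negative coefficient of [down] makes this a move upward. *)
  exists t => //; pose q := point_over x y + (- t)%:C *: @down R n.
  have qE : q = point_over x (y + t).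
    rewrite -(point_overE q) /q base_pointD base_pointZ base_point_down.
    rewrite base_point_over scaler0 mulr0 !addr0 heightD heightZ height_down.
    by rewrite height_over mulrN1 opprK -surjective_pairing.
  rewrite /S /= -qE; apply: dH; rewrite /rball /= /q addrC addKr rmorphN scaleNr.
  by rewrite rnormN rnormZ normc_real ?ltW //; clearbody t; lra.
have [[x0 nb]|bd] := pselect (exists x, ~ has_ubound (S x)).
  exists (fun=> +oo%E); split; first by right.
  apply/seteqP; split=> z // _; first by rewrite /hypograph /= ltry.
  rewrite SE; apply: contrapT => nSz; apply: nb.
  exists (height z + C * eucl_dist (base_point z) x0) => y Sy.
  rewrite leNgt; apply/negP => zy; apply: nSz; apply: Scone Sy; lra.
pose s x := sup (S x).
have hs x : has_sup (S x).
  split; first by exists (r x - 1); apply: Sr; lra.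
  by apply: contrapT => nbx; apply: bd; exists x.
have s_ub x y : S x y -> y <= s x by move=> Sy; apply: ub_le_sup => //; exact: (hs x).2.
have s_le x x' : s x - C * eucl_dist x' x <= s x'.
  rewrite lerBlDr; apply: ge_sup; first exact: (hs x).1.
  move=> y Sy; rewrite -lerBlDr; apply: s_ub; apply: Scone Sy; exact: lexx.
exists (fun x => (s x)%:E); split.
  left; exists s; split=> // [x y|x].
    have := s_le x y; have := s_le y x; rewrite (eucl_distC x y) ler_norml; lra.
  apply/ler_addgt0Pr => e e0; have := s_ub x (r x - e) (Sr _ _ _); lra.
apply/seteqP; split=> z; rewrite /hypograph /= lte_fin -/(height z) SE.
  by move=> /Sopen[d d0 /s_ub]; lra.
move=> zs; have d0 : 0 < s (base_point z) - height z by lra.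
have [y Sy ys] := sup_adherent d0 (hs (base_point z)).
apply: Sdown Sy; rewrite -/(s _) in ys; lra.
Qed.

Lemma hypograph_downward r : eucl_lipschitz C r -> forall (t : R) w, 0 <= t ->
  hypograph (fun x => (r x)%:E) w ->
  hypograph (fun x => (r x)%:E) (w + t%:C *: @down R n).
Proof. by move=> hr t w t0; apply: hypograph_cone hr _; exact: in_cone_downZ. Qed.

Lemma hypograph_steep r : eucl_lipschitz C r -> forall w, exists T : R,
  0 <= T /\ forall (s : R) z, 0 <= s -> hypograph (fun x => (r x)%:E) z ->
    hypograph (fun x => (r x)%:E) (z + s%:C *: (w + T%:C *: @down R n)).
Proof.
move=> hr w; exists `|C * base_norm w + height w|; split=> // s z s0.
apply: hypograph_cone hr _; apply: in_coneZ => //; apply: in_cone_down.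
exact: ler_norm.
Qed.

(** From a fixed point [p] of the hypograph, w - p + t [down] is in the cone once [t] is at least
    [L] times the norm of w - p, which is bounded on the ball. The absolute value of [rho] keeps the
    threshold nonnegative for empty balls. *)
Lemma hypograph_absorbing r : eucl_lipschitz C r -> forall c (rho : R),
  exists2 T : R, 0 <= T & forall t w, T <= t -> rball c rho w ->
    hypograph (fun x => (r x)%:E) (w + t%:C *: @down R n).
Proof.
move=> hr c rho; have C0 := eucl_lipschitz_ge0 hr.
pose p : V := point_over (0, 0) (r (0, 0) - 1).
have Hp : hypograph (fun x => (r x)%:E) p.
  by rewrite /hypograph /= -/(height _) height_over base_point_over lte_fin; lra.
pose L := C * n.+1%:R + 1; have L0 : 0 <= L by rewrite addr_ge0 // mulr_ge0.
exists (L * (`|rho| + rnorm (c - p))).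
  by rewrite mulr_ge0 // addr_ge0 ?rnorm_ge0.
move=> t w Tt wc; have -> : w + t%:C *: @down R n = p + (w - p + t%:C *: @down R n).
  by rewrite addrA [p + _]addrC subrK.
apply: hypograph_cone hr _ Hp; apply: in_cone_down; apply: le_trans Tt.
have h1 := ler_wpM2l C0 (base_norm_le (w - p)).
have h2 := height_le_rnorm (w - p).
apply: (@le_trans _ _ (L * rnorm (w - p))); first by
  rewrite /L mulrDl mul1r mulrA in h1 *; lra.
apply: ler_wpM2l => //.
have -> : w - p = (w - c) + (c - p) by rewrite addrA subrK.
apply: le_trans (rnormD _ _) _; rewrite lerD2r.
by apply: le_trans (ler_norm rho); exact: ltW.
Qed.

End ConeInvariance.

(** * Riemann domains *)

Section RiemannDomains.
Variables (R : realType) (n : nat).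
Local Notation V := 'CV[R]_n.+1.
Local Notation K := (complex R)^o.

Section Charts.
Variables (X : topologicalType) (p : X -> V) (U : set X) (g : V -> X).
Hypothesis chart : is_chart p U g.

Lemma chart_nbhs x : U x -> nbhs x U.
Proof. by case: chart => oU _ _ _ _ Ux; exact: open_nbhs_nbhs. Qed.

Lemma chart_image_nbhs w : (p @` U) w -> nbhs w (p @` U).
Proof. by case: chart => _ oU _ _ _ Uw; exact: open_nbhs_nbhs. Qed.

Lemma chart_proj_continuous x : U x -> {for x, continuous p}.
Proof.
case: chart => oU _ cp _ _ Ux.
by rewrite continuous_open_subspace // in cp; apply: cp; rewrite inE.
Qed.

Lemma chart_preimage_rball x c (rho : R) : U x -> rball c rho (p x) ->
  nbhs x (p @^-1` rball c rho).
Proof. by move=> Ux xr; apply: (chart_proj_continuous Ux); exact: rball_nbhs. Qed.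

Lemma chart_inv_continuous w : (p @` U) w -> {for w, continuous g}.
Proof.
case: chart => _ oU _ cg _ Uw.
by rewrite continuous_open_subspace // in cg; apply: cg; rewrite inE.
Qed.

Lemma chartK x : U x -> g (p x) = x.
Proof. by case: chart => _ _ _ _; exact. Qed.

Lemma chart_inv w : (p @` U) w -> U (g w) /\ p (g w) = w.
Proof. by case=> x Ux <-; rewrite (chartK Ux). Qed.

End Charts.

(** By continuity [g w] stays in [U'] for [w] near [p x], and there [g'] inverts the projection. *)
Lemma charts_agree (X : topologicalType) (p : X -> V) U g U' g' x :
  is_chart p U g -> is_chart p U' g' -> U x -> U' x ->
  \forall w \near p x, g w = g' w.
Proof.
move=> ch ch' Ux U'x.
have pUx : (p @` U) (p x) by exists x.
have gU' : nbhs (p x) (g @^-1` U').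
  apply: (chart_inv_continuous ch pUx); rewrite (chartK ch Ux).
  exact: (chart_nbhs ch' U'x).
apply: filterS (filterI gU' (chart_image_nbhs ch pUx)) => w [/= U'gw].
move=> /(chart_inv ch)[_ pgw].
by rewrite -[in RHS]pgw (chartK ch' U'gw).
Qed.

(** [S] consists of the points where, in some chart, the extended functions are given by a
    continuation along a chain. It is nonempty, open and closed, so it is all of the connected space
    [X]. *)
Lemma proj_sub_hull (D : set V) (X : riemann_domain R n) (alpha : V -> X) :
  open D -> D !=set0 -> holomorphic_extension D alpha ->
  forall x : X, hull D (rd_proj x).
Proof.
move=> oD [z0 Dz0] [calpha palpha ext].
rewrite continuous_open_subspace // in calpha.
(* A continuation acts on all functions at once, so the extensions are chosen simultaneously, with 0
   for functions not holomorphic on [D]. *)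
have ext_ex (f : V -> K) : exists F : X -> K, holomorphic_on D f ->
    rd_holomorphic F /\ forall z, D z -> F (alpha z) = f z.
  have [/ext[F FP]|nf] := pselect (holomorphic_on D f); first by exists F.
  by exists (fun=> 0) => /nf.
have [ex exP] := choice ext_ex.
pose S : set X := [set x | exists c (rho : R) E U g,
  [/\ continuation D c rho E, is_chart (@rd_proj R n X) U g, U x,
      rball c rho (rd_proj x) &
      rball c rho `<=` @rd_proj R n X @` U /\
      forall f, holomorphic_on D f -> forall w, rball c rho w -> E f w = ex f (g w)]].
suff S1 : S = [set: X].
  move=> x; have : S x by rewrite S1.
  by move=> [c [rho [E [U [g [cE _ _ xr _]]]]]]; exists c, rho, E.
apply: (@rd_connected R n X).
- exists (alpha z0).
  have [U [g [Ux ch]]] := rd_local_homeo (alpha z0).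
  have pz0 : (@rd_proj R n X @` U) z0 by exists (alpha z0) => //; exact: palpha.
  have aU : nbhs z0 (alpha @^-1` U).
    by apply: calpha; [rewrite inE|exact: (chart_nbhs ch)].
  have Dn : nbhs z0 D by exact: open_nbhs_nbhs.
  have [rho rho0 rhoP] := (nbhs_rballP z0 _).1
    (filterI (filterI aU Dn) (chart_image_nbhs ch pz0)).
  exists z0, rho, (fun f => ex f \o g), U, g; split=> //.
  + apply: continuation_base => // [w /rhoP[[]]|f fD w /rhoP[[Ua Dw] _]] //=.
    by rewrite -{1}(palpha _ Dw) (chartK ch Ua); exact: (exP f fD).2.
  + by rewrite palpha //; exact: rball_center.
  + by split=> [w /rhoP[]|].
- exists S; last by rewrite setTI.
  rewrite openE => x [c [rho [E [U [g [cE ch Ux xr [rU Ef]]]]]]].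
  have near_x : nbhs x (@rd_proj R n X @^-1` rball c rho).
    exact: (chart_preimage_rball ch Ux xr).
  apply: filterS (filterI near_x (chart_nbhs ch Ux)) => y [yr Uy].
  by exists c, rho, E, U, g.
- exists S; last by rewrite setTI.
  apply/closure_id/seteqP; split; first exact: subset_closure.
  move=> y Sy; have [U' [g' [U'y ch']]] := rd_local_homeo y.
  have pU'y : (@rd_proj R n X @` U') (rd_proj y) by exists y.
  have [rho' rho'0 rU'] := (nbhs_rballP _ _).1 (chart_image_nbhs ch' pU'y).
  have near_y : nbhs y (@rd_proj R n X @^-1` rball (rd_proj y) rho').
    exact: (chart_preimage_rball ch' U'y (rball_center _ rho'0)).
  (* A chart at the limit point [y] contains some [x] of [S], and its ball prolongs the chain of
     [x]. The two charts agree near the projection of [x], and the identity theorem extends the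
     agreement to the overlap of the balls. *)
  have [x [[c [rho [E [U [g [cE ch Ux xr [rU Ef]]]]]]] [xr' U'x]]] :=
    Sy _ (filterI near_y (chart_nbhs ch' U'y)).
  have xrr : (rball c rho `&` rball (rd_proj y) rho') (rd_proj x) by [].
  have Fg' f : holomorphic_on D f ->
      differentiable_on (rball (rd_proj y) rho') (ex f \o g').
    by move=> /exP[Fhol _] w /rU'; exact: Fhol.
  have cont' : continuation D (rd_proj y) rho' (fun f => ex f \o g').
    apply: (continuation_step cE rho'0); first by exists (rd_proj x).
    move=> f fD; split; first exact: Fg'.
    move=> w wr wr'; apply: (@identity_theorem R V
      (rball c rho `&` rball (rd_proj y) rho') _ _ (rd_proj x)).
    + by apply: openI; exact: open_rball.
    + by apply: rconvexI; exact: rconvex_rball.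
    + by move=> v [_ vr]; exact: Fg'.
    + by move=> v [vr _]; exact: (continuation_differentiable cE).
    + exact: xrr.
    + apply: filterS (filterI (rball_nbhs xr) (charts_agree ch ch' Ux U'x)) => v [vr gg'].
      by rewrite Ef //= gg'.
    + by split.
  exists (rd_proj y), rho', (fun f => ex f \o g'), U', g'.
  split; [exact: cont'|exact: ch'|exact: U'y|exact: rball_center|].
  by split; [exact: rU'|move=> f fD w wr].
Qed.

(* Unique lifting: [phi \o p] and the identity are lifts of [p] which agree at a
   point. *)
Lemma section_is_inverse (X : riemann_domain R n) (psi : X -> X) (x0 : X) :
  continuous psi -> (forall x, rd_proj (psi x) = rd_proj x) -> psi x0 = x0 ->
  forall x, psi x = x.
Proof.
move=> cpsi ppsi psi0.
suff S1 : [set x | psi x = x] = [set: X].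
  by move=> x; have : [set x | psi x = x] x by rewrite S1.
apply: (@rd_connected R n X).
- by exists x0.
- exists [set x | psi x = x]; last by rewrite setTI.
  rewrite openE => x /= psix.
  have [U [g [Ux ch]]] := rd_local_homeo x.
  have psiU : nbhs x (psi @^-1` U).
    by apply: cpsi; rewrite psix; exact: (chart_nbhs ch).
  apply: filterS (filterI psiU (chart_nbhs ch Ux)) => y [psiUy Uy].
  by rewrite /= -(chartK ch psiUy) ppsi (chartK ch Uy).
- exists [set x | psi x = x]; last by rewrite setTI.
  apply/closure_id/seteqP; split; first exact: subset_closure.
  move=> x clx; apply: (@rd_hausdorff R n X) => A B psixA xB.
  have psiA : nbhs x (psi @^-1` A) by exact: cpsi.
  have [y [psiy [Ay By]]] := clx _ (filterI psiA xB).
  by exists y; split=> //; rewrite -psiy.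
Qed.

End RiemannDomains.

(** * Domains of C^m as envelopes, and uniqueness of the envelope *)

Section DomainAsRiemannDomain.
Local Open Scope complex_scope.
Variables (R : realType) (n : nat) (H : set 'CV[R]_n.+1).
Local Notation V := 'CV[R]_n.+1.
Hypotheses (oH : open H) (cH : connected H).

Lemma rd_proj_continuous (X : riemann_domain R n) : continuous (@rd_proj R n X).
Proof.
move=> x; have [U [g [Ux ch]]] := rd_local_homeo x.
exact: (chart_proj_continuous ch Ux).
Qed.

Lemma set_type_hausdorff : hausdorff_space (set_type H).
Proof.
move=> x y xy; apply: val_inj; apply: norm_hausdorff => A B xA yB.
have vA : nbhs x (set_val @^-1` A) by exact: initial_continuous.
have vB : nbhs y (set_val @^-1` B) by exact: initial_continuous.
by have [z [Az Bz]] := xy _ _ vA vB; exists (set_val z).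
Qed.

Variable x0 : set_type H.

(** Points outside of [H] go to the default [x0]. *)
Definition lift_point (z : V) : set_type H := insubd x0 z.

Lemma lift_point_continuous : {within H, continuous (lift_point)}.
Proof.
have lift_pointE : sigL H lift_point = id by apply/funext => x; exact: valKd.
apply/subspace_sigL_continuousP; rewrite lift_pointE => x; exact: cvg_id.
Qed.

Lemma lift_pointK z : H z -> set_val (lift_point z) = z.
Proof. by move=> Hz; apply: insubdK; rewrite inE. Qed.

Lemma set_val_range : set_val @` [set: set_type H] = H.
Proof.
apply/seteqP; split=> [_ [x _ <-]|z Hz]; first exact: set_valP.
by exists (lift_point z) => //; exact: lift_pointK.
Qed.

Lemma set_type_connected : connected [set: set_type H].
Proof.
rewrite (_ : setT = lift_point @` H).
  by apply: connected_continuous_connected => //; exact: lift_point_continuous.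
apply/seteqP; split=> // x _; exists (set_val x); first exact: set_valP.
exact: valKd.
Qed.

Lemma set_type_chart :
  is_chart (set_val : set_type H -> V) setT lift_point.
Proof.
split; first exact: openT.
- by rewrite set_val_range.
- by apply: continuous_subspaceT; exact: initial_continuous.
- by rewrite set_val_range; exact: lift_point_continuous.
- by move=> x _; exact: valKd.
Qed.

Definition subdomain : riemann_domain R n :=
  @RiemannDomain R n (set_type H) set_val set_type_hausdorff set_type_connected
    (fun x => ex_intro _ setT (ex_intro _ lift_point (conj I set_type_chart))).

(** Any other extension projects into [H], and this projection is the map required by maximality. *)
Lemma subdomain_envelope (D : set V) : open D -> D !=set0 -> D `<=` H ->
  (forall f, holomorphic_on D f -> exists F, holomorphic_on H F /\
     forall z, D z -> F z = f z) ->
  (forall (Y : riemann_domain R n) (beta : V -> Y),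
     holomorphic_extension D beta -> forall y : Y, H (rd_proj y)) ->
  is_envelope_of_holomorphy D (lift_point : V -> subdomain).
Proof.
move=> oD D0 DH ext maxH; split; first split.
- by apply: (continuous_subspaceW DH); exact: lift_point_continuous.
- by move=> z /DH Hz; exact: lift_pointK.
- move=> f /ext[F [Fhol Ff]]; exists (F \o set_val); split.
    (* In any chart [g] is a section of [set_val], so the function to be differentiated is [F] near
       [w]. *)
    move=> U g ch w pUw; have [_ pgw] := chart_inv ch pUw.
    have Hw : H w by rewrite -pgw; exact: set_valP.
    apply: near_eq_differentiable (Fhol _ Hw).
    apply: filterS (chart_image_nbhs ch pUw) => v /(chart_inv ch)[_ pgv].
    by rewrite /= -{1}pgv.
  by move=> z Dz; rewrite /= lift_pointK ?Ff //; exact: DH.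
move=> Y beta hY; have HY := maxH Y beta hY.
exists (fun y => lift_point (rd_proj y)); split.
- move=> y; apply: continuous_comp; first exact: rd_proj_continuous.
  have := lift_point_continuous; rewrite continuous_open_subspace //.
  by apply; rewrite inE.
- by move=> y; exact: lift_pointK.
- by case: hY => _ pb _ z Dz; rewrite pb.
Qed.

(** Maximality gives maps in both directions over C^m; [psi \o phi] is the identity by unique
    lifting. So the projection of [X] is as injective as that of [H], and [psi] shows that it
    reaches all of [H]. *)
Lemma envelope_unique (D : set V) (X : riemann_domain R n) (alpha : V -> X) :
  D !=set0 -> is_envelope_of_holomorphy D (lift_point : V -> subdomain) ->
  is_envelope_of_holomorphy D alpha ->
  schlicht X /\ range (@rd_proj R n X) = H.
Proof.
move=> [z0 Dz0] [ext0 max0] [extX maxX].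
have [phi [cphi pphi phiE]] := max0 X alpha extX.
have [psi [cpsi ppsi psiE]] := maxX subdomain _ ext0.
have psiphi x : psi (phi x) = x.
  apply: (@section_is_inverse R n X (psi \o phi) (alpha z0)).
  - by move=> y; apply: continuous_comp; [exact: cphi|exact: cpsi].
  - by move=> y; rewrite /= ppsi pphi.
  - by rewrite /= phiE // psiE.
split.
  move=> x y pxy; rewrite -(psiphi x) -(psiphi y); congr psi.
  by apply: val_inj; rewrite -[LHS]pphi -[RHS]pphi in pxy *.
apply/seteqP; split=> [_ [x _ <-]|z Hz].
  by rewrite -pphi; exact: set_valP.
by exists (psi (lift_point z)) => //; rewrite ppsi; exact: lift_pointK.
Qed.

End DomainAsRiemannDomain.

(** * The envelope of a Lipschitz hypograph *)

Theorem theorem1p5 (R : realType) (n : nat) (C : R) (r : 'CV[R]_n * R -> R)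
    (hr : eucl_lipschitz C r) :
  let Omega := hypograph (fun x => (r x)%:E) in
  (exists (X : riemann_domain R n) (alpha : 'CV[R]_n.+1 -> X),
      is_envelope_of_holomorphy Omega alpha) /\
  exists rt : 'CV[R]_n * R -> \bar R,
    ((exists s : 'CV[R]_n * R -> R,
        [/\ forall x, rt x = (s x)%:E, eucl_lipschitz C s &
            forall x, r x <= s x]) \/
     (forall x, rt x = +oo%E)) /\
    forall (X : riemann_domain R n) (alpha : 'CV[R]_n.+1 -> X),
      is_envelope_of_holomorphy Omega alpha ->
      schlicht X /\ range (@rd_proj R n X) = hypograph rt.
Proof.
move=> Omega.
have oO : open Omega := open_hypograph hr.
have [z0 Oz0] : Omega !=set0.
  exists (point_over (0, 0) (r (0, 0) - 1)).
  by rewrite /Omega /hypograph /= -/(height _) height_over base_point_over lte_fin; lra.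
have down_O := hypograph_downward hr.
have O_hull := sub_hull oO.
have oH : open (hull Omega) := @open_hull R _ Omega.
have cH : connected (hull Omega) := connected_hull (hypograph_steep hr) down_O.
have [rt [rtP rtE]] := cone_invariant_hypograph (eucl_lipschitz_ge0 hr) oH
  (fun v w vC => hull_translate (fun w => hypograph_cone hr vC) (w := w)) O_hull.
have O0 : Omega !=set0 by exists z0.
pose x0 : set_type (hull Omega) := exist _ z0 (mem_set (O_hull z0 Oz0)).
have env : is_envelope_of_holomorphy Omega
    (lift_point x0 : 'CV[R]_n.+1 -> subdomain oH cH x0).
  apply: subdomain_envelope => // [f fO|Y beta hY].
    exact: hull_extension oO down_O (hypograph_absorbing hr) fO.
  exact: proj_sub_hull hY.
split; first by exists (subdomain oH cH x0), (lift_point x0).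
(* The hull is one envelope; any other is compared with it. *)
exists rt; split=> // X alpha envX; rewrite -rtE.
exact: envelope_unique O0 env envX.
Qed.
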